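(* Let $k\ge2$, $\tau\in[0,r]$, and assume that the node intensity on the $i$-th cell $((i-1)r,ir]$ is a constant $\lambda_i>0$, $i=1,\ldots,k-1$. The variance of the $k$-hop path count $\sigma_k(kr-\tau)$ is given by $$\mathrm{Var}_\lambda[\sigma_k(kr-\tau)]=\sum_{l=1}^{k-1}\tau^{2k-2-l}\,\frac{\lambda_1^2\cdots\lambda_{k-1}^2}{(2k-2-l)!}\sum_{\substack{j_0+\cdots+j_l=k-1-l\\ j_0,\ldots,j_l\ge0}}\ \prod_{q=1}^l\frac{1}{\lambda_{j_0+\cdots+j_{q-1}+q}}\ \prod_{p=0}^l\binom{2j_p}{j_p}.$$
   Context: Fix $r>0$. Nodes form a Poisson point process on $[0,kr]$. Additional nodes are placed at $0$ and at $t\in[0,kr]$; two nodes are connected if and only if their distance is at most $r$. $\sigma_k(t)$ is the number of $k$-hops from $0$ to $t$, i.e. the number of $(k-1)$-tuples of Poisson nodes $0<x_1<\cdots<x_{k-1}<t$ with $x_{i+1}-x_i\le r$ for $i=0,\ldots,k-1$, where $x_0:=0$, $x_k:=t$. For $\tau\in[0,r]$, $\sigma_k(kr-\tau)$ depends almost surely only on nodes in cells $1,\ldots,k-1$. $\mathrm{Var}_\lambda$ denotes variance under the given intensities. *)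

(* Defs.v *)
From HB Require Import structures.
From mathcomp Require Import all_boot all_order all_algebra.
From mathcomp Require Import finmap.
From mathcomp Require Import all_classical all_reals all_analysis.

Set Implicit Arguments.
Unset Strict Implicit.
Unset Printing Implicit Defensive.

Import Order.TTheory GRing.Theory Num.Theory.
Import numFieldNormedType.Exports.

Local Open Scope classical_set_scope.
Local Open Scope ring_scope.

Definition point_count (R : realType) (T : Type) (X : T -> {fset R})
    (A : set R) (w : T) : nat :=
  #|` [fset x in X w | x \in A]%fset |.

(* Taking [B i := setT] for some [i] gives the product rule on subfamilies. *)
Definition mutually_independent (d : measure_display) (T : measurableType d)
    (R : realType) (P : probability T R) (n : nat) (N : 'I_n -> T -> nat) :=
  forall B : 'I_n -> set nat,
    P [set w | forall i, B i (N i w)] =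
    (\prod_(i < n) P [set w | B i (N i w)])%E.

(* [X] is a (simple) Poisson point process on [E] with intensity function
   [rho] with respect to Lebesgue measure. Since [rho] has a finite integral
   over [E], the configurations are finite subsets of [E].
   The second argument of [poisson_prob] is a dummy, and [poisson_prob] of
   rate 0 is the Dirac mass at 0. *)
Record poisson_process (d : measure_display) (T : measurableType d)
    (R : realType) (P : probability T R) (E : set R) (rho : R -> R)
    (X : T -> {fset R}) : Prop := PoissonProcess {
  intensity_ge0 : forall x, E x -> 0 <= rho x;
  intensity_integrable :
    (@lebesgue_measure R).-integrable E (EFin \o rho);
  nodes_in : forall w x, x \in X w -> E x;
  measurable_point_count : forall A : set R, measurable A -> A `<=` E ->
    measurable_fun [set: T] (point_count X A);
  poisson_point_count : forall A : set R, measurable A -> A `<=` E ->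
    forall B : set nat,
      P [set w | B (point_count X A w)] =
      poisson_prob (\int[@lebesgue_measure R]_(x in A) rho x) 0 B;
  independent_point_count : forall (n : nat) (A : 'I_n -> set R),
    (forall i, measurable (A i)) -> (forall i, A i `<=` E) ->
    trivIset [set: 'I_n] A ->
    mutually_independent P (fun i => point_count X (A i))
}.

(* For [s = [:: x_1; ...; x_m]], with [x_0 = 0] and [x_(m+1) = t]:
   [x_i < x_(i+1)] and [x_(i+1) - x_i <= r] for [0 <= i <= m]. *)
Definition hop_path (R : realType) (r t : R) (s : seq R) : bool :=
  path (fun x y => (x < y) && (y - x <= r)) 0 (rcons s t).

(* The number of [k]-hops from 0 to [t] when the set of nodes is [X]. *)
Definition sigma (R : realType) (r : R) (k : nat) (X : {fset R}) (t : R) : nat :=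
  #|[pred s : (k.-1).-tuple X | hop_path r t [seq val x | x <- s]]|.

(* Main.v *)
(** The coordinates [u_i = i r - x_i] of a [k]-hop satisfy
    [0 <= u_1 <= ... <= u_(k-1) <= tau], where [x_i] lies in the [i]-th cell;
    almost surely [sigma] is therefore the number of nondecreasing chains formed
    with one point from each of [k-1] independent Poisson processes on
    [[0, tau)]. Cutting [[0, tau)] into [n] equal cells turns this number into a
    polynomial in independent Poisson variables, which converges pointwise to it
    and is dominated by its value for [n = 1]. The second moment of the
    polynomial counts pairs of weak chains of cells, weighted by their
    coincidences. Decomposing a pair at its coincidences [s_1 < ... < s_l]
    yields convolutions of squares of binomial coefficients, whose leading
    coefficients are the central binomial coefficients; the gaps between
    coincidences are the [j_0, ..., j_l] of the formula, and [l = 0] is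
    the square of the mean. *)
Require Import Defs.
From HB Require Import structures.
From mathcomp Require Import all_boot all_order all_algebra.
From mathcomp Require Import finmap.
From mathcomp Require Import all_classical all_reals all_analysis.
From mathcomp Require Import measurable_realfun.
From mathcomp Require Import ring lra zify.

Set Implicit Arguments.
Unset Strict Implicit.
Unset Printing Implicit Defensive.

Import Order.TTheory GRing.Theory Num.Theory.
Import numFieldNormedType.Exports.

Local Open Scope classical_set_scope.
Local Open Scope ring_scope.

(** * Counting multichains *)

(* The number of sequences [c_1 <= ... <= c_j] in [{0, ..., n-1}]. *)
Definition multichains (j n : nat) : nat := 'C((n + j).-1, j).

Lemma multichains0n n : multichains 0 n = 1%N.
Proof. by rewrite /multichains bin0. Qed.

Lemma multichainsS0 j : multichains j.+1 0 = 0%N.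
Proof. by rewrite /multichains bin_small. Qed.

Lemma multichainsSS j n :
  multichains j.+1 n.+1 = (multichains j.+1 n + multichains j n.+1)%N.
Proof. by rewrite /multichains !addSn !addnS /= binS. Qed.

Lemma multichains_sum j n :
  (\sum_(c < n) multichains j c.+1)%N = multichains j.+1 n.
Proof.
elim: n => [|n IHn]; first by rewrite big_ord0 multichainsS0.
by rewrite big_ord_recr /= IHn multichainsSS.
Qed.

(** Split a multichain of length [i + j + 1] at its entry of rank [i + 1], of value [c]: the earlier
    entries lie in [{0, ..., c}], the later ones in [{c, ..., n-1}]. *)
Lemma multichains_conv i j n :
  (\sum_(c < n) multichains i c.+1 * multichains j (n - c))%N =
  multichains (i + j).+1 n.
Proof.
elim: j n => [|j IHj] n.
  under eq_bigr do rewrite multichains0n muln1.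
  by rewrite multichains_sum addn0.
elim: n => [|n IHn]; first by rewrite big_ord0 multichainsS0.
rewrite (eq_bigr (fun c : 'I_n.+1 =>
    multichains i c.+1 * multichains j.+1 (n - c) +
    multichains i c.+1 * multichains j (n.+1 - c))%N); last first.
  by move=> c _; rewrite subSn ?leq_ord// multichainsSS mulnDr.
rewrite big_split /= IHj big_ord_recr /= subnn multichainsS0 muln0 addn0 IHn.
by rewrite addnS [RHS]multichainsSS.
Qed.

(** Absorption for binomial coefficients: multiplication by [n] preserves the span of the multichain
    counts. *)
Lemma mul_multichains j n :
  (n * multichains j n + j * multichains j n =
   j.+1 * multichains j.+1 n)%N.
Proof.
rewrite -mulnDl /multichains addnS /=.
(* The predecessor in [multichains] is truncated only for [n = j = 0]. *)
case: (posnP (n + j)) => [/eqP|nj].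
  by rewrite addn_eq0 => /andP[/eqP-> /eqP->].
by rewrite -mul_bin_diag.
Qed.

Lemma cvg_sumr (R : realType) (I : Type) (s : seq I) (P : pred I)
    (f : I -> nat -> R) (l : I -> R) :
  (forall i, P i -> f i n @[n --> \oo] --> l i) ->
  \sum_(i <- s | P i) f i n @[n --> \oo] --> \sum_(i <- s | P i) l i.
Proof. by move=> fl; apply: cvg_big => // x; exact: add_continuous. Qed.

(** * Sequences spanned by multichain counts *)

Section has_degree.
Variable R : realType.
Implicit Types (f g : nat -> R) (p q : nat) (a b : R).

(* Since [multichains i n ~ n ^ i / i!], this entails [f n ~ a n ^ p / p!]; unlike
   the asymptotic statement, it is preserved by convolution at once. *)
Definition has_degree f p a := exists2 phi : nat -> R, phi p = a &
  forall n, f n = \sum_(i < p.+1) phi i * (multichains i n)%:R.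

Lemma has_degree_eq f g p a : f =1 g -> has_degree f p a -> has_degree g p a.
Proof. by move=> fg [phi phip fE]; exists phi => // n; rewrite -fg. Qed.

Lemma has_degreeD f g p a b :
  has_degree f p a -> has_degree g p b ->
  has_degree (fun n => f n + g n) p (a + b).
Proof.
move=> [phi <- fE] [psi <- gE]; exists (fun i => phi i + psi i) => // n.
by rewrite fE gE -big_split; apply: eq_bigr => i _; rewrite mulrDl.
Qed.

Lemma has_degreeZ c f p a :
  has_degree f p a -> has_degree (fun n => c * f n) p (c * a).
Proof.
move=> [phi <- fE]; exists (fun i => c * phi i) => // n.
by rewrite fE mulr_sumr; apply: eq_bigr => i _; rewrite mulrA.
Qed.

Lemma has_degree_sum (I : Type) (s : seq I) (P : pred I) (F : I -> nat -> R)
    (c : I -> R) p :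
  (forall i, P i -> has_degree (F i) p (c i)) ->
  has_degree (fun n => \sum_(i <- s | P i) F i n) p (\sum_(i <- s | P i) c i).
Proof.
move=> Fc; elim: s => [|i s IHs].
  by exists (fun=> 0) => [|n]; rewrite ?big_nil// big1// => i; rewrite mul0r.
rewrite big_cons; under [fun n => _]eq_fun do rewrite big_cons.
by case: ifPn => // Pi; apply: has_degreeD => //; exact: Fc.
Qed.

Lemma has_degree_multichains i p : (i <= p)%N ->
  has_degree (fun n => (multichains i n)%:R) p (i == p)%:R.
Proof.
move=> ip; exists (fun j => (i == j)%:R) => // n.
rewrite (bigD1 (Ordinal (ip : (i < p.+1)%N)))//= eqxx mul1r big1 ?addr0// => j.
by rewrite -val_eqE /= eq_sym => /negPf ->; rewrite mul0r.
Qed.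

(** The basis sequences of index [i] and [j] convolve to the one of index [i + j + 1], so only
    [i = p], [j = q] reach the top index. *)
Lemma has_degree_conv f g p q a b :
  has_degree f p a -> has_degree g q b ->
  has_degree (fun n => \sum_(c < n) f c.+1 * g (n - c)%N) (p + q).+1 (a * b).
Proof.
move=> [phi <- fE] [psi <- gE].
have -> : phi p * psi q = \sum_(i < p.+1) \sum_(j < q.+1)
    phi i * psi j * ((i + j).+1 == (p + q).+1)%:R.
  rewrite big_ord_recr /= big_ord_recr /= eqxx mulr1 !big1 ?add0r//.
    by move=> j _; rewrite eqSS eqn_add2l ltn_eqF ?mulr0.
  move=> i _; rewrite big1// => j _; rewrite eqSS ltn_eqF ?mulr0//.
  by rewrite -addSn leq_add// -ltnS.
apply: (@has_degree_eq (fun n => \sum_(i < p.+1) \sum_(j < q.+1)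
    phi i * psi j * (multichains (i + j).+1 n)%:R)).
  move=> n; under [RHS]eq_bigr do rewrite fE gE mulr_suml.
  rewrite [RHS]exchange_big /=; apply: eq_bigr => i _.
  under [RHS]eq_bigr do rewrite mulr_sumr.
  rewrite [RHS]exchange_big /=; apply: eq_bigr => j _.
  rewrite -multichains_conv natr_sum mulr_sumr; apply: eq_bigr => c _.
  by rewrite natrM mulrACA.
apply: has_degree_sum => i _; apply: has_degree_sum => j _.
by apply: has_degreeZ; apply: has_degree_multichains; rewrite ltnS leq_add// -ltnS.
Qed.

Lemma has_degreeS f p a : has_degree f p a -> has_degree f p.+1 0.
Proof.
(* Nothing constrains [phi] beyond [p], so its value at [p.+1] is reset to 0. *)
move=> [phi _ fE]; exists (fun i => if (i == p.+1)%N then 0 else phi i) => [|n].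
  by rewrite eqxx.
rewrite fE [RHS]big_ord_recr /= eqxx mul0r addr0.
by apply: eq_bigr => i _; rewrite ltn_eqF.
Qed.

Lemma has_degree_natr f p a : has_degree f p a ->
  has_degree (fun n => n%:R * f n) p.+1 (p.+1%:R * a).
Proof.
move=> [phi <- fE].
have -> : p.+1%:R * phi p = \sum_(i < p.+1)
   (phi i * i.+1%:R * (i.+1 == p.+1)%:R + - (phi i * i%:R) * (i == p.+1 :> nat)%:R).
  rewrite big_ord_recr /= eqxx mulr1 big1 ?add0r => [|i _].
    by rewrite ltn_eqF// mulr0 addr0 mulrC.
  by rewrite eqSS !ltn_eqF ?mulr0 ?addr0// ltnS ltnW.
apply: (@has_degree_eq (fun n => \sum_(i < p.+1)
   (phi i * i.+1%:R * (multichains i.+1 n)%:R +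
    - (phi i * i%:R) * (multichains i n)%:R))).
  move=> n; rewrite fE mulr_sumr; apply: eq_bigr => i _.
  rewrite -mulrA -natrM -mul_multichains natrD !natrM; ring.
apply: has_degree_sum => i _; apply: has_degreeD; apply: has_degreeZ.
  exact: has_degree_multichains.
by apply: has_degree_multichains; rewrite ltnW.
Qed.

(** On leading terms, [n^i/i!] times [n^j/j!] is [C(i+j, i) n^(i+j)/(i+j)!]. The induction on [i]
    rests on [mul_multichains]. *)
Lemma has_degreeM_multichains i j :
  has_degree (fun n => (multichains i n)%:R * (multichains j n)%:R)
             (i + j) 'C(i + j, i)%:R.
Proof.
elim: i => [|i IHi].
  apply: (@has_degree_eq (fun n => (multichains j n)%:R)).
    by move=> n; rewrite multichains0n mul1r.
  by rewrite bin0 add0n; have := has_degree_multichains (leqnn j); rewrite eqxx.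
have -> : 'C(i.+1 + j, i.+1)%:R = i.+1%:R^-1 *
    ((i + j).+1%:R * 'C(i + j, i)%:R + i%:R * 0) :> R.
  rewrite mulr0 addr0 -natrM mul_bin_diag natrM mulrA mulVf ?mul1r ?pnatr_eq0//.
apply: (@has_degree_eq (fun n => i.+1%:R^-1 *
    (n%:R * ((multichains i n)%:R * (multichains j n)%:R) +
     i%:R * ((multichains i n)%:R * (multichains j n)%:R)))).
  move=> n; rewrite [n%:R * _]mulrA [i%:R * _]mulrA -mulrDl.
  rewrite -[n%:R * _]natrM -[i%:R * _]natrM -natrD mul_multichains natrM -mulrA.
  by rewrite mulKf// pnatr_eq0.
apply: has_degreeZ; apply: has_degreeD; first exact: has_degree_natr.
by apply: has_degreeZ; exact: has_degreeS IHi.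
Qed.

(** The surplus exponent [d] treats together the leading term ([d = 0]) and the lower ones, which
    vanish in the limit. *)
Lemma cvg_multichains i d :
  n.+1%:R^-1 ^+ (i + d) * (multichains i n.+1)%:R @[n --> \oo]
    --> ((d == 0%N)%:R / i`!%:R : R).
Proof.
have h0 : (n.+1%:R^-1 : R) @[n --> \oo] --> 0 by exact: cvg_harmonic.
elim: i => [|i IHi].
  under eq_fun do rewrite multichains0n mulr1 add0n.
  rewrite fact0 divr1; case: d => [|d] /=.
    by under eq_fun do rewrite expr0; exact: cvg_cst.
  under eq_fun do rewrite exprS.
  rewrite -[_%:R](mul0r (0 ^+ d : R)); apply: cvgM => //.
  by apply: (@continuous_cvg _ _ _ _ _ _ (fun x : R => x ^+ d)) => //; exact: exprn_continuous.
have -> : (d == 0%N)%:R / i.+1`!%:R =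
    i.+1%:R^-1 * ((1 + i%:R * 0) * ((d == 0%N)%:R / i`!%:R)) :> R.
  rewrite factS natrM invfM; ring.
suff -> : (fun n => n.+1%:R^-1 ^+ (i.+1 + d) * (multichains i.+1 n.+1)%:R) =
  (fun n => i.+1%:R^-1 * ((1 + i%:R * n.+1%:R^-1) *
     (n.+1%:R^-1 ^+ (i + d) * (multichains i n.+1)%:R))) :> (nat -> R).
  apply: cvgMl_tmp; apply: cvgM => //.
  by apply: cvgD; [exact: cvg_cst|exact: cvgMl_tmp].
apply/funext => n.
have -> : (multichains i.+1 n.+1)%:R =
    i.+1%:R^-1 * (n.+1%:R + i%:R) * (multichains i n.+1)%:R :> R.
  rewrite -natrD -mulrA -natrM mulnDl mul_multichains natrM mulrA.
  by rewrite mulVf ?mul1r// pnatr_eq0.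
rewrite addSn exprS.
have : (n.+1%:R : R) != 0 by rewrite pnatr_eq0.
by move=> n0; field; rewrite !nat1r !pnatr_eq0.
Qed.

Lemma cvg_has_degree f p a : has_degree f p a ->
  n.+1%:R^-1 ^+ p * f n.+1 @[n --> \oo] --> a / p`!%:R.
Proof.
move=> [phi <- fE].
have -> : (fun n => n.+1%:R^-1 ^+ p * f n.+1) = (fun n => \sum_(i < p.+1)
   phi i * (n.+1%:R^-1 ^+ (i + (p - i)) * (multichains i n.+1)%:R)).
  apply/funext => n; rewrite fE mulr_sumr; apply: eq_bigr => i _.
  by rewrite subnKC -1?ltnS// mulrCA.
have -> : phi p / p`!%:R =
    \sum_(i < p.+1) phi i * (((p - i)%N == 0%N)%:R / i`!%:R).
  rewrite big_ord_recr /= subnn eqxx mul1r big1 ?add0r// => i _.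
  by rewrite subn_eq0 leqNgt ltn_ord mul0r mulr0.
apply: cvg_sumr => i _; apply: cvgMl_tmp; exact: cvg_multichains.
Qed.

End has_degree.

(** * Pairs of chains *)

Section pair_chains.
Variable R : realType.
Implicit Types (w : nat -> nat -> nat -> R) (lam mu : nat -> R).

(* The sum over [c_0 <= ... <= c_(m-1) < a] of the product of the [N i (c_i)]. *)
Fixpoint chains (N : nat -> nat -> R) (m a : nat) : R :=
  if m is m'.+1 then \sum_(c < a) N m' c * chains N m' c.+1 else 1.

(** The weight [w i c c'] need not factor, so that the mixed moment of two counts can take its
    place. *)
Fixpoint pair_chains w (m a b : nat) : R :=
  if m is m'.+1 then
    \sum_(c < a) \sum_(c' < b) w m' c c' * pair_chains w m' c.+1 c'.+1
  else 1.

Lemma chainsM (N : nat -> nat -> R) m a b :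
  chains N m a * chains N m b =
  pair_chains (fun i c c' => N i c * N i c') m a b.
Proof.
elim: m a b => [|m IHm] a b /=; first by rewrite mulr1.
rewrite mulr_suml; apply: eq_bigr => c _; rewrite mulr_sumr.
by apply: eq_bigr => c' _; rewrite -IHm mulrACA.
Qed.

(** The second chain is confined to cell 0, so that results on pairs of chains cover single
    chains. *)
Lemma chains_pair (N : nat -> nat -> R) m a :
  chains N m a = pair_chains (fun i c c' => N i c) m a 1.
Proof.
elim: m a => [|m IHm] a //=.
by apply: eq_bigr => c _; rewrite big_ord_recr big_ord0 /= add0r IHm.
Qed.

Lemma chains_const lam (h : R) m a :
  chains (fun i _ => lam i * h) m a =
  (\prod_(i < m) lam i) * (h ^+ m * (multichains m a)%:R).
Proof.
elim: m a => [|m IHm] a /=; first by rewrite big_ord0 multichains0n !mulr1.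
under eq_bigr do rewrite IHm.
rewrite -!mulr_sumr -natr_sum multichains_sum big_ord_recr exprS /=; ring.
Qed.

Lemma sum_diag (f : nat -> nat -> R) a b :
  \sum_(c < a) \sum_(c' < b) (c == c' :> nat)%:R * f c c' =
  \sum_(v < minn a b) f v v.
Proof.
rewrite (big_ord_widen a (fun v => f v v) (geq_minl a b)) [RHS]big_mkcond /=.
apply: eq_bigr => c _; rewrite leq_min ltn_ord /=; case: ltnP => cb.
  rewrite (bigD1 (Ordinal cb))//= eqxx mul1r big1 ?addr0// => c'.
  by rewrite -val_eqE /= eq_sym => /negPf ->; rewrite mul0r.
rewrite big1// => c' _; rewrite gtn_eqF ?mul0r//.
exact: leq_trans (ltn_ord c') cb.
Qed.

Lemma multichains_sum_from j v a :
  (\sum_(c < a | v <= c) multichains j (c.+1 - v))%N = multichains j.+1 (a - v).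
Proof.
elim: a => [|a IHa]; first by rewrite big_ord0 multichainsS0.
rewrite big_mkcond big_ord_recr /= -big_mkcond /= IHa.
case: leqP => [va|av]; first by rewrite subSn// multichainsSS.
by move: av (ltnW av); rewrite addn0 -!subn_eq0 => /eqP -> /eqP ->.
Qed.

(** This adds one level on top of two chains issued from a common cell [v]: once the sum over [v] is
    outermost, those over [c] and [c'] separate. *)
Lemma sum_multichains_min (G : nat -> R) j a b :
  \sum_(c < a) \sum_(c' < b) \sum_(v < minn c.+1 c'.+1)
    G v * ((multichains j (c.+1 - v))%:R * (multichains j (c'.+1 - v))%:R) =
  \sum_(v < minn a b)
    G v * ((multichains j.+1 (a - v))%:R * (multichains j.+1 (b - v))%:R).
Proof.
(* Zero factors replace the constraints [v <= c] and [v <= c'], so that all ranges are fixed and the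
   sums can be exchanged. *)
transitivity (\sum_(c < a) \sum_(c' < b) \sum_(v < minn a b)
    G v * ((if (v <= c)%N then (multichains j (c.+1 - v))%:R else 0) *
           (if (v <= c')%N then (multichains j (c'.+1 - v))%:R else 0))).
  apply: eq_bigr => c _; apply: eq_bigr => c' _.
  rewrite (big_ord_widen (minn a b) (fun v => G v *
    ((multichains j (c.+1 - v))%:R * (multichains j (c'.+1 - v))%:R))); last first.
    by rewrite leq_min !geq_min !ltn_ord orbT.
  rewrite big_mkcond /=; apply: eq_bigr => v _; rewrite leq_min !ltnS.
  by case: (leqP v c); case: (leqP v c'); rewrite /= ?mulr0 ?mul0r ?mulr0.
under eq_bigr do rewrite exchange_big /=.
rewrite exchange_big /=; apply: eq_bigr => v _.
rewrite -!multichains_sum_from !natr_sum mulr_suml mulr_sumr [in RHS]big_mkcond.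
apply: eq_bigr => c _ /=; rewrite -mulr_sumr; case: ifP => _; last first.
  by rewrite big1 ?mulr0// => c' _; rewrite mul0r.
by rewrite -mulr_sumr [in RHS]big_mkcond.
Qed.

(* The mixed moment of the counts of cells [c] and [c'] of level [i], when
   all the cells of this level have mass [mu i]. *)
Definition poisson_weight mu (i c c' : nat) : R :=
  mu i ^+ 2 + (c == c')%:R * mu i.

(* Conditioning on the last level [s] at which the two chains coincide. *)
Lemma pair_chains_poisson mu m a b :
  pair_chains (poisson_weight mu) m a b =
  (\prod_(i < m) mu i ^+ 2) * ((multichains m a)%:R * (multichains m b)%:R) +
  \sum_(s < m) mu s * (\prod_(s.+1 <= i < m) mu i ^+ 2) *
    \sum_(v < minn a b) pair_chains (poisson_weight mu) s v.+1 v.+1 *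
      ((multichains (m - s.+1) (a - v))%:R * (multichains (m - s.+1) (b - v))%:R).
Proof.
elim: m a b => [|m IHm] a b.
  by rewrite !big_ord0 !multichains0n /= !mulr1 addr0.
(* The top level splits into its product part and its coincidence part, carried by the diagonal. *)
rewrite [LHS](_ : _ = mu m ^+ 2 *
    (\sum_(c < a) \sum_(c' < b) pair_chains (poisson_weight mu) m c.+1 c'.+1) +
  mu m * \sum_(v < minn a b) pair_chains (poisson_weight mu) m v.+1 v.+1); last first.
  rewrite /= -(sum_diag (fun c c' => pair_chains (poisson_weight mu) m c.+1 c'.+1)).
  rewrite !mulr_sumr -big_split /=; apply: eq_bigr => c _.
  rewrite !mulr_sumr -big_split /=; apply: eq_bigr => c' _.
  by rewrite /poisson_weight mulrDl; congr +%R; ring.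
(* The diagonal part is the term [s = m], where the last coincidence is at the top level. *)
rewrite [X in _ = _ + X]big_ord_recr /= subnn big_geq// mulr1 addrA.
congr (_ + mu m * _); last first.
  by apply: eq_bigr => v _; rewrite !multichains0n !mulr1.
under eq_bigr do under eq_bigr do rewrite IHm.
under eq_bigr do rewrite big_split /= -!mulr_sumr.
rewrite big_split /= -mulr_sumr -mulr_suml -!natr_sum !multichains_sum mulrDr.
rewrite [X in _ = X * _ + _]big_ord_recr /= mulrA [_ * mu m ^+ 2]mulrC; congr +%R.
under eq_bigr do rewrite exchange_big /=.
rewrite exchange_big /= mulr_sumr; apply: eq_bigr => s _.
under eq_bigr do rewrite -mulr_sumr.
rewrite -mulr_sumr (sum_multichains_min (fun v => pair_chains (poisson_weight mu) s v.+1 v.+1)).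
rewrite big_nat_recr /= ?subSn//.
ring.
Qed.

(* The contribution of the pairs with [l] selected coincidences to [pair_chains]. *)
Fixpoint pair_chains_coef lam (l m a : nat) : R :=
  if l is l'.+1 then
    \sum_(s < m) lam s * (\prod_(s.+1 <= i < m) lam i ^+ 2) *
      \sum_(v < a) pair_chains_coef lam l' s v.+1 *
         (multichains (m - s.+1) (a - v))%:R ^+ 2
  else (\prod_(i < m) lam i ^+ 2) * (multichains m a)%:R ^+ 2.

Lemma pair_chains_coef_small lam l m a : (m < l)%N ->
  pair_chains_coef lam l m a = 0.
Proof.
elim: l m a => [//|l IHl] m a ml /=.
apply: big1 => s _; rewrite [X in _ * X]big1 ?mulr0// => v _.
by rewrite IHl ?mul0r//; exact: leq_trans (ltn_ord s) ml.
Qed.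

(** The conditioning on the last coincidence is iterated, hence the strong induction. A pair carries
    two factors [h] per level, less one per coincidence. *)
Lemma pair_chains_coefE lam (h : R) m a :
  pair_chains (poisson_weight (fun i => lam i * h)) m a a =
  \sum_(l < m.+1) h ^+ (2 * m - l) * pair_chains_coef lam l m a.
Proof.
elim/ltn_ind: m a => m IHm a.
rewrite pair_chains_poisson big_ord_recl /= subn0; congr +%R.
  under eq_bigr do rewrite exprMn.
  by rewrite big_split /= prodr_const card_ord -exprM; ring.
rewrite minnn.
transitivity (\sum_(s < m) \sum_(l < m) h ^+ (2 * m - l.+1) *
   (lam s * (\prod_(s.+1 <= i < m) lam i ^+ 2) *
    \sum_(v < a) pair_chains_coef lam l s v.+1 *
         (multichains (m - s.+1) (a - v))%:R ^+ 2)).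
  apply: eq_bigr => s _; under [X in _ * X = _]eq_bigr do rewrite (IHm _ (ltn_ord s)) mulr_suml.
  rewrite [X in _ * X = _]exchange_big /= mulr_sumr.
  (* The range of [l] is made independent of [s]; the added coefficients are 0, since [s] levels
     cannot hold more than [s] coincidences. *)
  rewrite (big_ord_widen m (fun l => lam s * h * \prod_(s.+1 <= i < m) (lam i * h) ^+ 2 *
     \sum_(v < a) h ^+ (2 * s - l) * pair_chains_coef lam l s v.+1 *
     ((multichains (m - s.+1) (a - v))%:R * (multichains (m - s.+1) (a - v))%:R)))//.
  rewrite big_mkcond; apply: eq_bigr => l _; case: ltnP => ls; last first.
    rewrite [X in _ * (_ * X)]big1 ?mulr0// => v _.
    by rewrite pair_chains_coef_small ?mul0r.
  under eq_bigr do rewrite exprMn.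
  rewrite big_split /= prodr_const_nat -exprM.
  under [X in _ * X = _]eq_bigr do rewrite -mulrA -expr2.
  rewrite -mulr_sumr.
  (* One factor [h] comes from the coincidence at [s], two from each level above, and the last term
     from the levels below. *)
  have -> : (2 * m - l.+1 = 1 + 2 * (m - s.+1) + (2 * s - l))%N.
    by have := ltn_ord s; rewrite ltnS in ls; lia.
  rewrite !exprD expr1; ring.
by rewrite exchange_big; apply: eq_bigr => l _ /=; rewrite mulr_sumr.
Qed.

(** The leading coefficient of [pair_chains_coef lam l m]: squared multichain counts become central
    binomial coefficients, and convolutions over [v] become products. *)
Fixpoint top_coef lam (l m : nat) : R :=
  if l is l'.+1 then
    \sum_(s < m) lam s * (\prod_(s.+1 <= i < m) lam i ^+ 2) *
      (top_coef lam l' s * 'C(2 * (m - s.+1), m - s.+1)%:R)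
  else (\prod_(i < m) lam i ^+ 2) * 'C(2 * m, m)%:R.

Lemma top_coef_small lam l m : (m < l)%N -> top_coef lam l m = 0.
Proof.
elim: l m => [//|l IHl] m ml /=.
apply: big1 => s _.
by rewrite IHl ?mul0r ?mulr0//; exact: leq_trans (ltn_ord s) ml.
Qed.

Lemma has_degree_coef lam l m : (l <= m)%N ->
  has_degree (pair_chains_coef lam l m) (2 * m - l) (top_coef lam l m).
Proof.
have sqr j : has_degree (fun n => (multichains j n)%:R ^+ 2 : R)
                        (2 * j) 'C(2 * j, j)%:R.
  by rewrite mul2n -addnn; exact: has_degreeM_multichains.
elim: l m => [|l IHl] m lm /=; first by rewrite subn0; exact: has_degreeZ.
apply: has_degree_sum => s _; apply: has_degreeZ.
(* For [s < l] the summand is identically 0; the degree count below relies on [l <= s]. *)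
have [ls|sl] := leqP l s; last first.
  rewrite top_coef_small// mul0r.
  exists (fun=> 0) => // n; rewrite !big1// => [i _|v _]; first by rewrite mul0r.
  by rewrite pair_chains_coef_small ?mul0r.
have -> : (2 * m - l.+1 = (2 * s - l + 2 * (m - s.+1)).+1)%N.
  by have := ltn_ord s; lia.
exact: (has_degree_conv (IHl _ ls) (sqr _)).
Qed.

(** The power of [tau / n.+1] before each coefficient is the degree of that coefficient, so every
    [l] has a finite limit. *)
Lemma cvg_pair_chains lam (tau : R) m :
  pair_chains (poisson_weight (fun i => lam i * (tau / n.+1%:R))) m n.+1 n.+1
    @[n --> \oo] -->
  \sum_(l < m.+1) tau ^+ (2 * m - l) * (top_coef lam l m / (2 * m - l)`!%:R).
Proof.
under eq_fun do rewrite pair_chains_coefE.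
apply: cvg_sumr => l _; under eq_fun do rewrite exprMn -mulrA.
by apply: cvgMl_tmp; apply: cvg_has_degree; apply: has_degree_coef; rewrite -ltnS.
Qed.

Lemma cvg_chains lam (tau : R) m :
  chains (fun i _ => lam i * (tau / n.+1%:R)) m n.+1 @[n --> \oo] -->
  (\prod_(i < m) lam i) * (tau ^+ m / m`!%:R).
Proof.
under eq_fun do rewrite chains_const exprMn -mulrA.
apply: cvgMl_tmp; apply: cvgMl_tmp.
have := cvg_has_degree (has_degree_multichains R (leqnn m)).
by rewrite eqxx mul1r.
Qed.

(** As [C(2m, m)/(2m)! = 1/m!^2], the term without coincidences is the squared mean, to be cancelled
    in the variance. *)
Lemma top_coef0E lam (tau : R) m :
  tau ^+ (2 * m - 0) * (top_coef lam 0 m / (2 * m - 0)`!%:R) =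
  ((\prod_(i < m) lam i) * (tau ^+ m / m`!%:R)) ^+ 2.
Proof.
rewrite subn0 /= prodrXl !exprMn exprVn -exprM [(m * 2)%N]mulnC.
have -> : (2 * m)`!%:R = 'C(2 * m, m)%:R * m`!%:R ^+ 2 :> R.
  rewrite expr2 -!natrM -(bin_fact (leq_pmull m (isT : 0 < 2)%N)).
  by rewrite mul2n -addnn addnK.
have C0 : 'C(2 * m, m)%:R != 0 :> R.
  by rewrite pnatr_eq0 -lt0n bin_gt0 leq_pmull.
have f0 : m`!%:R != 0 :> R by rewrite pnatr_eq0 -lt0n fact_gt0.
by field; rewrite C0 f0.
Qed.

End pair_chains.

(** * The sum over compositions *)

Section composition_sum.

Definition ffun_rcons (T : finType) n (j : {ffun 'I_n -> T}) (x : T) :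
    {ffun 'I_n.+1 -> T} :=
  [ffun i => if unlift ord_max i is Some i' then j i' else x].

Lemma ffun_rcons_last (T : finType) n (j : {ffun 'I_n -> T}) (x : T) :
  ffun_rcons j x ord_max = x.
Proof. by rewrite ffunE unlift_none. Qed.

Lemma ffun_rcons_widen (T : finType) n (j : {ffun 'I_n -> T}) (x : T) i :
  ffun_rcons j x (widen_ord (leqnSn n) i) = j i.
Proof.
have -> : widen_ord (leqnSn n) i = lift ord_max i by apply: ord_inj; rewrite lift_max.
by rewrite ffunE liftK.
Qed.

Lemma sum_ffun_recr (V : nmodType) (T : finType) n (F : {ffun 'I_n.+1 -> T} -> V) :
  \sum_j F j = \sum_x \sum_j F (ffun_rcons j x).
Proof.
rewrite pair_big /= (reindex (fun p : T * {ffun 'I_n -> T} => ffun_rcons p.2 p.1))//.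
exists (fun j : {ffun 'I_n.+1 -> T} => (j ord_max, [ffun i => j (widen_ord (leqnSn n) i)])).
  move=> [x j] _ /=; rewrite ffun_rcons_last; congr pair.
  by apply/ffunP => i; rewrite ffunE ffun_rcons_widen.
move=> j _; apply/ffunP => i /=; rewrite ffunE.
case: unliftP => [i' ->|->//]; rewrite ffunE; congr (j _).
by apply: ord_inj; rewrite lift_max.
Qed.

Variable R : realType.
Implicit Types lambda : nat -> R.

(** The total [m] is kept apart from the bound [k] to allow recursion on [l] and [m]; any [k > m]
    gives the same sum. The additive constraint avoids truncated subtraction. *)
Definition composition_sum lambda (k l m : nat) : R :=
  \sum_(j : {ffun 'I_l.+1 -> 'I_k} | (\sum_(p < l.+1) j p + l == m)%N)
    (\prod_(1 <= q < l.+1)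
       (lambda (\sum_(p < l.+1 | (p < q)%N) j p + q)%N)^-1) *
    (\prod_(p < l.+1) 'C(2 * j p, j p)%:R).

Lemma composition_sum0 lambda k m : (m < k)%N ->
  composition_sum lambda k 0 m = 'C(2 * m, m)%:R.
Proof.
move=> mk; rewrite /composition_sum big_mkcond sum_ffun_recr.
rewrite (bigD1 (Ordinal mk))//= (bigD1 [ffun i => Ordinal mk])//=.
rewrite big_ord_recr big_ord0 /= ffun_rcons_last addn0 eqxx.
rewrite big_geq// big_ord_recr big_ord0 /= ffun_rcons_last !mul1r.
rewrite !big1 ?addr0// => [x|j].
  rewrite -val_eqE /= => /negPf xm; rewrite big1// => j _.
  by rewrite big_ord_recr big_ord0 /= ffun_rcons_last addn0 xm.
by case/negP; apply/eqP/ffunP => -[].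
Qed.

(** The last gap is summed first: if it is [m - s.+1], the last coincidence has index [s.+1] and the
    other gaps form a composition for the total [s]. *)
Lemma composition_sumS lambda k l m : (m < k)%N ->
  composition_sum lambda k l.+1 m =
  \sum_(s < m) (lambda s.+1)^-1 *
    (composition_sum lambda k l s * 'C(2 * (m - s.+1), m - s.+1)%:R).
Proof.
move=> mk; rewrite /composition_sum big_mkcond sum_ffun_recr.
(* After reversal the index is the last gap [x], with [s = m - x.+1]. *)
rewrite [RHS](reindex_inj rev_ord_inj) /=.
rewrite (big_ord_widen k (fun x => (lambda (m - x.+1).+1)^-1 *
  ((\sum_(j : {ffun 'I_l.+1 -> 'I_k} | (\sum_(p < l.+1) j p + l == m - x.+1)%N)
    (\prod_(1 <= q < l.+1)
       (lambda (\sum_(p < l.+1 | (p < q)%N) j p + q)%N)^-1) *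
    (\prod_(p < l.+1) 'C(2 * j p, j p)%:R)) *
   'C(2 * (m - (m - x.+1).+1), m - (m - x.+1).+1)%:R)) (ltnW mk)).
rewrite [RHS]big_mkcond; apply: eq_bigr => x _.
have sumE (j : {ffun 'I_l.+1 -> 'I_k}) (q : nat) : (q <= l.+1)%N ->
    (\sum_(p < l.+2 | (p < q)%N) ffun_rcons j x p =
     \sum_(p < l.+1 | (p < q)%N) j p)%N.
  move=> ql; rewrite big_mkcond big_ord_recr /= ltnNge ql addn0 -big_mkcond /=.
  by apply: eq_bigr => p _; rewrite ffun_rcons_widen.
have sumTE (j : {ffun 'I_l.+1 -> 'I_k}) :
    (\sum_(p < l.+2) ffun_rcons j x p = \sum_(p < l.+1) j p + x)%N.
  rewrite big_ord_recr /= ffun_rcons_last; congr addn.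
  by apply: eq_bigr => p _; rewrite ffun_rcons_widen.
case: ltnP => [xm|mx]; last first.
  rewrite big1// => j _; rewrite sumTE ifF//; apply/negbTE; lia.
rewrite mulr_suml mulr_sumr -big_mkcond /=; apply: eq_big => [j|j].
  rewrite sumTE; move: (\sum_(p < l.+1) j p)%N => S; apply/eqP/eqP; lia.
rewrite sumTE => /eqP jm.
have -> : (m - (m - x.+1).+1 = x)%N by lia.
rewrite big_nat_recr //= [X in _ * X = _]big_ord_recr /= ffun_rcons_last.
have -> : (\sum_(p < l.+2 | (p < l.+1)%N) ffun_rcons j x p + l.+1 = (m - x.+1).+1)%N.
  rewrite sumE// (eq_bigl xpredT) => [|p]; last by rewrite ltn_ord.
  by move: jm xm; move: (\sum_(p < l.+1) j p)%N => S; lia.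
under [X in _ * (X * _) = _]eq_bigr do rewrite ffun_rcons_widen.
rewrite (eq_big_nat _ _ (F2 := fun q =>
   (lambda (\sum_(p < l.+1 | (p < q)%N) j p + q)%N)^-1)); last first.
  by move=> q /andP[_ ql]; rewrite sumE// ltnW.
ring.
Qed.

(** A coincidence contributes an intensity in place of its square, whence an inverse intensity once
    all squares are factored out. *)
Lemma top_coefE lambda k l m : (m < k)%N ->
  (forall i, (i < m)%N -> lambda i.+1 != 0) ->
  top_coef (fun i => lambda i.+1) l m =
  (\prod_(i < m) lambda i.+1 ^+ 2) * composition_sum lambda k l m.
Proof.
elim: l m => [|l IHl] m mk lambda0 /=; first by rewrite composition_sum0.
rewrite composition_sumS// mulr_sumr; apply: eq_bigr => s _.
rewrite IHl ?(ltn_trans _ mk)//; last first.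
  by move=> i /ltn_trans; move=> /(_ _ (ltn_ord s)); exact: lambda0.
rewrite -(big_mkord xpredT (fun i => lambda i.+1 ^+ 2)).
rewrite -(big_mkord xpredT (fun i => lambda i.+1 ^+ 2)).
rewrite [X in _ = X * _](big_cat_nat _ (n := s.+1) (p := m))//= big_nat_recr//=.
by field; exact: lambda0.
Qed.

End composition_sum.

(** * Expectations of functions of counts *)

Section integral_off_null.
Import HBNNSimple.
Local Open Scope ereal_scope.
Context d (T : measurableType d) (R : realType).
Variable mu : {measure set T -> \bar R}.

(* Neither function has to be measurable: [sigma] is only known to coincide
   almost surely with a measurable function. *)
Lemma ge0_le_integral_off_null (N : set T) (f g : T -> \bar R) :
  measurable N -> mu N = 0 ->
  (forall x, 0 <= f x) -> (forall x, 0 <= g x) ->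
  (forall x, ~ N x -> f x <= g x) ->
  \int[mu]_x f x <= \int[mu]_x g x.
Proof.
move=> mN N0 f0 g0 fg; rewrite !ge0_integralTE//.
apply: ge_ereal_sup => _ /= [h hf <-].
have mNC : measurable (~` N) by exact: measurableC.
(* A simple function below [f], cut off on [N], lies below [g] and keeps its integral. *)
apply: ereal_sup_ubound; exists (proj_nnsfun h mNC).
  move=> x; rewrite /proj_nnsfun /= mindicE.
  have [xN|xN] := boolP (x \in ~` N); last by rewrite mulr0.
  rewrite mulr1 (le_trans (hf x))// fg//; exact: set_mem xN.
rewrite -!integralT_nnsfun; apply: ge0_ae_eq_integral => //.
- exact/measurable_EFinP.
- exact/measurable_EFinP.
- by move=> x _; rewrite lee_fin.
- by move=> x _; rewrite lee_fin.
exists N; split=> // x /= /not_implyP[_] /eqP; apply: contraNP => xN.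
by rewrite /proj_nnsfun /= mindicE mem_set ?mulr1.
Qed.

Lemma ge0_eq_integral_off_null (N : set T) (f g : T -> \bar R) :
  measurable N -> mu N = 0 ->
  (forall x, 0 <= f x) -> (forall x, 0 <= g x) ->
  (forall x, ~ N x -> f x = g x) ->
  \int[mu]_x f x = \int[mu]_x g x.
Proof.
move=> mN N0 f0 g0 fg; apply/eqP; rewrite eq_le; apply/andP; split.
  by apply: (ge0_le_integral_off_null mN) => // x /fg ->.
by apply: (ge0_le_integral_off_null mN) => // x /fg ->.
Qed.

End integral_off_null.

(** * Independence and Poisson moments of integer-valued variables *)

Section nat_valued.
Local Open Scope ereal_scope.
Context d (T : measurableType d) (R : realType) (P : probability T R).

Lemma measurable_nat_comp (N : T -> nat) (f : nat -> R) :
  measurable_fun [set: T] N -> measurable_fun [set: T] (f \o N).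
Proof.
by move=> mN _ Y _; have := mN measurableT (f @^-1` Y) I; rewrite !setTI; exact.
Qed.

Lemma measurable_prodr (I : Type) (s : seq I) (p : pred I) (f : I -> T -> R) :
  (forall i, p i -> measurable_fun [set: T] (f i)) ->
  measurable_fun [set: T] (fun w => (\prod_(i <- s | p i) f i w)%R).
Proof.
move=> mf; elim: s => [|i s IHs]; first by under eq_fun do rewrite big_nil; exact: measurable_cst.
case: (boolP (p i)) => pi; last by under eq_fun do rewrite big_cons (negbTE pi).
by under eq_fun do rewrite big_cons pi; apply: measurable_funM => //; exact: mf.
Qed.

Lemma measurable_nat_preimage (N : T -> nat) (B : set nat) :
  measurable_fun [set: T] N -> measurable [set w | B (N w)].
Proof. by move=> mN; have := mN measurableT B I; rewrite setTI; exact. Qed.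

Lemma ge0_integral_nat (N : T -> nat) (f : nat -> R) (h : T -> R) :
  measurable_fun [set: T] N -> measurable_fun [set: T] h ->
  (forall n, (0 <= f n)%R) -> (forall w, (0 <= h w)%R) ->
  \int[P]_w (f (N w) * h w)%:E =
  \sum_(n <oo) (f n)%:E * \int[P]_w (\1_[set n] (N w) * h w)%:E.
Proof.
move=> mN mh f0 h0.
transitivity (\int[P]_w \sum_(n <oo) (f n * (\1_[set n] (N w) * h w))%:E).
  apply: eq_integral => w _; rewrite (@nneseriesD1 _ _ (N w))//; last first.
    by move=> n _; rewrite lee_fin !mulr_ge0.
  rewrite indicE mem_set// mul1r eseries0 ?adde0// => n _ /= /eqP nN.
  by rewrite indicE memNset ?mul0r ?mulr0// => /esym.
rewrite integral_nneseries//; last 2 first.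
- move=> n; apply/measurable_EFinP; apply: measurable_funM => //.
  by apply: measurable_funM => //; exact: (@measurable_nat_comp N \1_[set n]).
- by move=> n w _; rewrite lee_fin !mulr_ge0.
apply: eq_eseriesr => n _; under eq_integral do rewrite EFinM.
rewrite ge0_integralZl//.
- apply/measurable_EFinP; apply: measurable_funM => //.
  exact: (@measurable_nat_comp N \1_[set n]).
- by move=> w _; rewrite lee_fin mulr_ge0.
- by rewrite lee_fin.
Qed.

(** Reading the series as integrals for the counting measure allows an infinite factor [c]. *)
Lemma ge0_nneseriesZl (a : (\bar R)^nat) (c : \bar R) :
  (forall n, 0 <= a n) -> 0 <= c ->
  \sum_(n <oo) c * a n = c * \sum_(n <oo) a n.
Proof.
move=> a0 c0; rewrite -!ge0_integral_count//; last by move=> n; rewrite mule_ge0.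
by rewrite ge0_integralZl.
Qed.

Lemma integral_indic_nat (N : T -> nat) (B : set nat) :
  measurable_fun [set: T] N ->
  \int[P]_w (\1_B (N w))%:E = P [set w | B (N w)].
Proof.
move=> mN; rewrite -[X in P X]setIT -integral_indic//.
exact: measurable_nat_preimage.
Qed.

Lemma ge0_integral_nat_pmf (N : T -> nat) (f : nat -> R) :
  measurable_fun [set: T] N -> (forall n, (0 <= f n)%R) ->
  \int[P]_w (f (N w))%:E = \sum_(n <oo) (f n)%:E * P [set w | N w = n].
Proof.
move=> mN f0; transitivity (\int[P]_w (f (N w) * cst 1%R w)%:E).
  by apply: eq_integral => w _; rewrite mulr1.
rewrite ge0_integral_nat//; apply: eq_eseriesr => n _.
by under eq_integral do rewrite mulr1; rewrite (integral_indic_nat [set n]).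
Qed.

Lemma integral_prod_independent n (N : 'I_n -> T -> nat) (f : 'I_n -> nat -> R) :
  (forall i, measurable_fun [set: T] (N i)) -> mutually_independent P N ->
  (forall i k, (0 <= f i k)%R) ->
  \int[P]_w (\prod_(i < n) f i (N i w))%:E =
  \prod_(i < n) \int[P]_w (f i (N i w))%:E.
Proof.
move=> mN indep f0.
(* Independence is the case where all factors are indicators. By induction on [s], the factors of
   index below [s] become arbitrary one at a time. *)
suff : forall s f, (forall i k, (0 <= f i k)%R) ->
    (forall i : 'I_n, (s <= i)%N -> exists B : set nat, f i = \1_B) ->
    \int[P]_w (\prod_(i < n) f i (N i w))%:E =
    \prod_(i < n) \int[P]_w (f i (N i w))%:E.
  by move/(_ n f f0); apply => i; rewrite leqNgt ltn_ord.
move=> {f f0}; elim=> [|s IHs] f f0 fB.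
  have {}fB i : exists B : set nat, f i = \1_B by exact: fB.
  have [B BE] := choice fB.
  under [RHS]eq_bigr do rewrite BE integral_indic_nat//.
  rewrite -indep -[X in P X]setIT -integral_indic//; last first.
    rewrite [X in measurable X](_ : _ = \bigcap_(i in [set: 'I_n]) [set w | B i (N i w)]).
      by apply: fin_bigcap_measurable => // i _; exact: measurable_nat_preimage.
    by apply/seteqP; split => w /= Bw i => [_|]; exact: Bw.
  apply: eq_integral => w _; congr EFin; rewrite [RHS]indicE.
  have [/set_mem/= Bw|/negP Bw] := boolP (w \in _).
    by rewrite big1// => i _; rewrite BE indicE mem_set.
  have [i iB] : exists i, ~ B i (N i w).
    by apply/existsNP; apply: contra_not Bw => Bw; exact/mem_set.
  by rewrite (bigD1 i)//= BE indicE memNset// mul0r.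
have [ns|sn] := leqP n s.
  by apply: IHs => // i; rewrite leqNgt (leq_trans (ltn_ord i) ns).
pose i0 := Ordinal sn.
have mprod g : measurable_fun [set: T] (fun w => \prod_(i < n | i != i0) g i (N i w) : R)%R.
  by apply: measurable_prodr => i _; exact: measurable_nat_comp.
transitivity (\int[P]_w (f i0 (N i0 w) * \prod_(i < n | i != i0) f i (N i w))%:E).
  by apply: eq_integral => w _; rewrite (bigD1 i0).
rewrite ge0_integral_nat//; last by move=> w; rewrite prodr_ge0.
rewrite (bigD1 i0)//= ge0_integral_nat_pmf//.
pose C := \prod_(i < n | i != i0) \int[P]_w (f i (N i w))%:E.
rewrite -/C.
have C0 : 0 <= C by apply: prode_ge0 => i _; apply: integral_ge0 => w _; rewrite lee_fin.
rewrite muleC -ge0_nneseriesZl//; last by move=> k; rewrite mule_ge0// lee_fin.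
apply: eq_eseriesr => k _; rewrite [RHS]muleCA; congr (_ * _).
(* Expanding factor [i0] over its values [k] turns it into indicators, to which the induction
   hypothesis applies. *)
pose f' i := if i == i0 then \1_[set k] else f i.
have f'E (i : 'I_n) : i != i0 -> f' i = f i by rewrite /f' => /negPf ->.
have f'0 : f' i0 = \1_[set k] by rewrite /f' eqxx.
transitivity (\int[P]_w (\prod_(i < n) f' i (N i w))%:E).
  apply: eq_integral => w _; rewrite [in RHS](bigD1 i0)//= f'0.
  by congr (_ * _)%:E; apply: eq_bigr => i /f'E ->.
rewrite IHs.
- rewrite (bigD1 i0)//= f'0 (integral_indic_nat [set k])// muleC.
  by congr (_ * _); apply: eq_bigr => i /f'E ->.
- by move=> i l; rewrite /f'; case: ifP.
move=> i si; have [->|ii0] := eqVneq i i0; first by rewrite f'0; exists [set k].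
rewrite f'E//; apply: fB; rewrite ltn_neqAle si andbT eq_sym.
by apply: contra ii0 => /eqP is0; apply/eqP/val_inj.
Qed.

Section poisson_moments.
Variables (N : T -> nat) (mu : R).
Hypothesis mN : measurable_fun [set: T] N.
Hypothesis mu0 : (0 <= mu)%R.
Hypothesis N_poisson : forall B, P [set w | B (N w)] = poisson_prob mu 0 B.

Lemma poisson_pmfE n :
  P [set w | N w = n] = (mu ^+ n * n`!%:R^-1 * expR (- mu))%:E.
Proof.
rewrite (N_poisson [set n]) /poisson_prob /poisson_pmf.
case: ifPn => [mup|]; first by rewrite esum_set1 mup// lee_fin !mulr_ge0 ?exprn_ge0 ?expR_ge0 ?invr_ge0. 
(* At rate 0 the law is the Dirac mass at 0, which fits the formula because [0 ^+ 0 = 1]. *)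
rewrite -leNgt => mu_le0; have -> : mu = 0%R by apply/eqP; rewrite eq_le mu_le0.
rewrite oppr0 expR0 mulr1 diracE expr0n.
have [->|n0] := eqVneq n 0%N; first by rewrite fact0 invr1 mulr1 mem_set.
by rewrite mul0r memNset//= => /esym /eqP; apply/negP.
Qed.

(* The Stein-Chen identity for the Poisson distribution. *)
Lemma integral_poisson_stein (g : nat -> R) : (forall n, (0 <= g n)%R) ->
  \int[P]_w ((N w)%:R * g (N w))%:E = mu%:E * \int[P]_w (g (N w).+1)%:E.
Proof.
move=> g0.
rewrite (@ge0_integral_nat_pmf N (fun n => n%:R * g n)%R)//; last by move=> n; rewrite mulr_ge0.
rewrite (@ge0_integral_nat_pmf N (fun n => g n.+1))//.
rewrite nneseries_recl//; last by move=> n _; rewrite mule_ge0// lee_fin mulr_ge0.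
rewrite mul0r mul0e add0e -nneseriesZl//; last first.
  by move=> n _; rewrite mule_ge0// lee_fin.
rewrite -(nneseries_addn 1%N) //; last first.
  by move=> n; rewrite mule_ge0// lee_fin mulr_ge0.
(* Termwise this is [(n+1) p_(n+1) = mu p_n] for the Poisson weights. *)
apply: eq_eseriesr => n _; rewrite addn1 !poisson_pmfE -!EFinM; congr EFin.
by rewrite factS exprS natrM invfM; field; rewrite nat1r !pnatr_eq0 -lt0n fact_gt0.
Qed.

Lemma integral_poisson1 : \int[P]_w (N w)%:R%:E = mu%:E.
Proof.
have := @integral_poisson_stein (fun=> 1%R) (fun=> ler01).
rewrite integral_cst//= probability_setT !mule1 => <-.
by apply: eq_integral => w _; rewrite mulr1.
Qed.

Lemma integral_poisson2 : \int[P]_w ((N w)%:R ^+ 2)%:E = (mu ^+ 2 + mu)%:E.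
Proof.
transitivity (mu%:E * \int[P]_w ((N w).+1%:R)%:E).
  rewrite -(@integral_poisson_stein (fun n => n%:R))//.
under eq_integral do rewrite -natr1 EFinD.
rewrite ge0_integralD//.
- rewrite integral_poisson1 integral_cst//= probability_setT mule1.
  by rewrite -EFinD -EFinM mulrDr mulr1 expr2.
- exact/measurable_EFinP/(@measurable_nat_comp N (fun n => n%:R)).
Qed.

End poisson_moments.

End nat_valued.

(** * Expectation of sums over pairs of chains *)

Section integral_pair_chains.
Local Open Scope ereal_scope.
Context d (T : measurableType d) (R : realType).
Variable mu : {measure set T -> \bar R}.

Lemma pair_chains_ge0 (w : nat -> nat -> nat -> R) j a b :
  (forall i c c', (0 <= w i c c')%R) -> (0 <= pair_chains w j a b)%R.
Proof.
move=> w0; elim: j a b => [|j IHj] a b //=.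
by apply: sumr_ge0 => c _; apply: sumr_ge0 => c' _; exact: mulr_ge0.
Qed.

Lemma measurable_pair_chains (w : nat -> nat -> nat -> T -> R) m n a b :
  (forall i c c', (i < m)%N -> (c <= n)%N -> (c' <= n)%N ->
    measurable_fun [set: T] (w i c c')) ->
  (a <= n.+1)%N -> (b <= n.+1)%N ->
  measurable_fun [set: T] (fun x => pair_chains (fun i c c' => w i c c' x) m a b).
Proof.
elim: m a b => [|m IHm] a b mw an bn /=; first exact: measurable_cst.
apply: measurable_sum => c; apply: measurable_sum => c'.
have ca := leq_trans (ltn_ord c) an; have cb := leq_trans (ltn_ord c') bn.
by apply: measurable_funM; [exact: mw|apply: IHm => // i ? ? im; apply: mw; exact: ltnW].
Qed.

Lemma integral_pair_chains (w : nat -> nat -> nat -> T -> R)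
    (e : nat -> nat -> nat -> R) m n :
  (forall i c c', (i < m)%N -> (c <= n)%N -> (c' <= n)%N ->
    measurable_fun [set: T] (w i c c')) ->
  (forall i c c' x, (0 <= w i c c' x)%R) ->
  (forall c c' : nat -> nat, (forall i, (c i <= n)%N) -> (forall i, (c' i <= n)%N) ->
    \int[mu]_x (\prod_(0 <= i < m) w i (c i) (c' i) x)%:E =
    (\prod_(0 <= i < m) e i (c i) (c' i))%:E) ->
  forall a b, (a <= n.+1)%N -> (b <= n.+1)%N ->
  \int[mu]_x (pair_chains (fun i c c' => w i c c' x) m a b)%:E =
  (pair_chains e m a b)%:E.
Proof.
move=> mw w0 we a b an bn.
(* The levels from [j] on are already expanded, at the cells given by [c] and [c']; [upd] below
   records the choice made at level [j]. *)
suff H j : (j <= m)%N -> forall a b (c c' : nat -> nat),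
    (a <= n.+1)%N -> (b <= n.+1)%N ->
    (forall i, (c i <= n)%N) -> (forall i, (c' i <= n)%N) ->
    \int[mu]_x (pair_chains (fun i c c' => w i c c' x) j a b *
       \prod_(j <= i < m) w i (c i) (c' i) x)%:E =
    (pair_chains e j a b * \prod_(j <= i < m) e i (c i) (c' i))%:E.
  have := H m (leqnn m) a b (fun=> 0%N) (fun=> 0%N) an bn.
  rewrite big_geq// mulr1 => <- //.
  by apply: eq_integral => x _; rewrite big_geq// mulr1.
elim: j => [_|j IHj jm] {an bn}a {}b c c' an bn cn c'n.
  by rewrite mul1r -we//; apply: eq_integral => x _; rewrite mul1r.
pose upd (f : nat -> nat) u i := if i == j then u else f i.
have updE (F : nat -> nat -> nat -> R) u u' :
    (F j u u' * \prod_(j.+1 <= i < m) F i (c i) (c' i) =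
     \prod_(j <= i < m) F i (upd c u i) (upd c' u' i))%R.
  rewrite [RHS]big_ltn// /upd eqxx; congr *%R.
  by apply: eq_big_nat => i /andP[ji _]; rewrite gtn_eqF.
have distrE (F : nat -> nat -> nat -> R) :
    (pair_chains F j.+1 a b * \prod_(j.+1 <= i < m) F i (c i) (c' i) =
     \sum_(u < a) \sum_(u' < b) pair_chains F j u.+1 u'.+1 *
       \prod_(j <= i < m) F i (upd c u i) (upd c' u' i))%R.
  rewrite /= mulr_suml; apply: eq_bigr => u _; rewrite mulr_suml.
  by apply: eq_bigr => u' _; rewrite -updE mulrCA mulrA.
rewrite distrE; under eq_integral do rewrite distrE -sumEFin.
have updn f u : (forall i, (f i <= n)%N) -> (u <= n)%N -> forall i, (upd f u i <= n)%N.
  by move=> fn un i; rewrite /upd; case: ifP.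
have mterm u u' : (u <= n)%N -> (u' <= n)%N -> measurable_fun [set: T] (fun x =>
    pair_chains (fun i c c' => w i c c' x) j u.+1 u'.+1 *
       \prod_(j <= i < m) w i (upd c u i) (upd c' u' i) x)%R.
  move=> un u'n; apply: measurable_funM.
    by apply: (@measurable_pair_chains _ _ n) => // i ? ? ij; apply: mw; exact: ltn_trans jm.
  under eq_fun do rewrite big_nat_cond.
  by apply: measurable_prodr => i /andP[/andP[_ im] _]; apply: mw => //; exact: updn.
have term0 u u' x : (0 <= pair_chains (fun i c c' => w i c c' x) j u.+1 u'.+1 *
       \prod_(j <= i < m) w i (upd c u i) (upd c' u' i) x)%R.
  by rewrite mulr_ge0 ?prodr_ge0//; exact: pair_chains_ge0.
have ord_le k (u : 'I_k) : (k <= n.+1)%N -> (u <= n)%N.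
  by move=> kn; rewrite -ltnS (leq_trans (ltn_ord u)).
rewrite ge0_integral_sum//; last 2 first.
- by move=> u; apply/measurable_EFinP; apply: measurable_sum => u'; apply: mterm; exact: ord_le.
- by move=> u x _; rewrite lee_fin; apply: sumr_ge0.
rewrite -sumEFin; apply: eq_bigr => u _.
under eq_integral do rewrite -sumEFin.
rewrite ge0_integral_sum//; last 2 first.
- by move=> u'; apply/measurable_EFinP; apply: mterm; exact: ord_le.
- by move=> u' x _; rewrite lee_fin.
have un := ord_le _ u an.
rewrite -sumEFin; apply: eq_bigr => u' _; have u'n := ord_le _ u' bn.
apply: IHj; rewrite ?ltnS//; first exact: ltnW.
- exact: updn.
- exact: updn.
Qed.

End integral_pair_chains.

(** * Moments of chains of cells of a Poisson process *)

Definition cell_count (T : Type) (R : realType) (X : T -> {fset R})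
  (A : nat -> nat -> set R) (i c : nat) (w : T) : R := (point_count X (A i c) w)%:R.

Lemma cell_count_ge0 (T : Type) (R : realType) (X : T -> {fset R})
  (A : nat -> nat -> set R) i c w : 0 <= cell_count X A i c w.
Proof. exact: ler0n. Qed.

Section poisson_array.
Local Open Scope ereal_scope.
Context d (T : measurableType d) (R : realType) (P : probability T R).
Variables (E : set R) (rho : R -> R) (X : T -> {fset R}).
Hypothesis X_poisson : poisson_process P E rho X.

(** An enumeration of [I] reduces this to ordinals; the general index type serves for pairs of a
    level and a boolean. *)
Lemma integral_prod_point_count (I : finType) (A : I -> set R) (f : I -> nat -> R) :
  (forall i, measurable (A i)) -> (forall i, A i `<=` E) ->
  trivIset [set: I] A -> (forall i k, (0 <= f i k)%R) ->
  \int[P]_w (\prod_i f i (point_count X (A i) w))%:E =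
  \prod_i \int[P]_w (f i (point_count X (A i) w))%:E.
Proof.
move=> mA AE tA f0.
rewrite [RHS](reindex (fun i : 'I_#|I| => enum_val i)) /=; last exact/onW_bij/enum_val_bij.
have := @integral_prod_independent _ _ _ P #|I|
  (fun i => point_count X (A (enum_val i))) (fun i => f (enum_val i)).
move=> <-//.
- apply: eq_integral => w _; congr EFin.
  by rewrite (reindex (fun i : 'I_#|I| => enum_val i)) //=; exact/onW_bij/enum_val_bij.
- by move=> i; apply: (measurable_point_count X_poisson).
apply: (independent_point_count X_poisson) => //.
by move=> i j _ _ ne; apply: enum_val_inj; exact: tA ne.
Qed.

Variables (m n : nat) (A : nat -> nat -> set R) (mu : nat -> R).
Hypothesis mA : forall i c, (i < m)%N -> (c <= n)%N -> measurable (A i c).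
Hypothesis AE : forall i c, (i < m)%N -> (c <= n)%N -> A i c `<=` E.
Hypothesis disjA : forall i c i' c' x, (i < m)%N -> (i' < m)%N ->
  (c <= n)%N -> (c' <= n)%N -> A i c x -> A i' c' x -> i = i' /\ c = c'.
Hypothesis rhoA : forall i c, (i < m)%N -> (c <= n)%N ->
  Rintegral (@lebesgue_measure R) (A i c) rho = mu i.
Hypothesis mu0 : forall i, (i < m)%N -> (0 <= mu i)%R.

Lemma measurable_cell_count i c : (i < m)%N -> (c <= n)%N ->
  measurable_fun [set: T] (cell_count X A i c).
Proof.
move=> im cn; apply: (@measurable_nat_comp _ _ _ (point_count X (A i c)) (fun n => n%:R)).
by apply: (measurable_point_count X_poisson); [exact: mA|exact: AE].
Qed.

Lemma integral_cell_count i c : (i < m)%N -> (c <= n)%N ->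
  \int[P]_w (cell_count X A i c w)%:E = (mu i)%:E.
Proof.
move=> im cn; apply: integral_poisson1; last 2 first.
- exact: mu0.
- move=> B; rewrite -(rhoA im cn).
  by apply: (poisson_point_count X_poisson); [exact: mA|exact: AE].
by apply: (measurable_point_count X_poisson); [exact: mA|exact: AE].
Qed.

Lemma integral_cell_count_sqr i c : (i < m)%N -> (c <= n)%N ->
  \int[P]_w (cell_count X A i c w ^+ 2)%:E = (mu i ^+ 2 + mu i)%:E.
Proof.
move=> im cn; apply: integral_poisson2; last 2 first.
- exact: mu0.
- move=> B; rewrite -(rhoA im cn).
  by apply: (poisson_point_count X_poisson); [exact: mA|exact: AE].
by apply: (measurable_point_count X_poisson); [exact: mA|exact: AE].
Qed.

Lemma measurable_chains a : (a <= n.+1)%N ->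
  measurable_fun [set: T] (fun w => chains (fun i c => cell_count X A i c w) m a).
Proof.
move=> an; under eq_fun do rewrite chains_pair.
apply: (@measurable_pair_chains _ _ _ (fun i c c' => cell_count X A i c) m n) => //.
by move=> i c c' im cn _; exact: measurable_cell_count.
Qed.

Lemma integral_chains a : (a <= n.+1)%N ->
  \int[P]_w (chains (fun i c => cell_count X A i c w) m a)%:E =
  (chains (fun i _ => mu i) m a)%:E.
Proof.
move=> an; rewrite chains_pair; under eq_integral do rewrite chains_pair.
apply: (@integral_pair_chains _ _ _ _ (fun i c c' => cell_count X A i c) _ m n) => //.
- by move=> i c c' im cn _; exact: measurable_cell_count.
move=> c _ cn _; rewrite big_mkord; under eq_integral do rewrite big_mkord.
rewrite (@integral_prod_point_count 'I_m (fun i => A i (c i)) (fun=> fun k => k%:R))//.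
- rewrite -prodEFin; apply: eq_bigr => i _; exact: integral_cell_count.
- by move=> i; exact: mA.
- by move=> i; exact: AE.
by move=> i j _ _ [x []] /disjA h /h => /(_ (ltn_ord i) (ltn_ord j) (cn i) (cn j))[/val_inj].
Qed.

Lemma integral_chains_sqr a : (a <= n.+1)%N ->
  \int[P]_w (chains (fun i c => cell_count X A i c w) m a ^+ 2)%:E =
  (pair_chains (poisson_weight mu) m a a)%:E.
Proof.
move=> an; under eq_integral do rewrite expr2 chainsM.
apply: (@integral_pair_chains _ _ _ _
  (fun i c c' w => cell_count X A i c w * cell_count X A i c' w)%R _ m n) => //.
- by move=> i c c' im cn c'n; apply: measurable_funM; exact: measurable_cell_count.
- by move=> i c c' w; rewrite mulr_ge0 ?cell_count_ge0.
move=> c c' cn c'n; rewrite big_mkord; under eq_integral do rewrite big_mkord.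
(* Equal cells are merged, so that the cells [B p] are pairwise disjoint. *)
pose B (p : 'I_m * bool) := if p.2 then if c p.1 == c' p.1 then set0 else A p.1 (c' p.1)
  else A p.1 (c p.1).
(* When the cells coincide, slot [false] carries the squared count and slot [true] the factor 1 on
   the empty set. *)
pose f (p : 'I_m * bool) k : R :=
  if c p.1 == c' p.1 then if p.2 then 1%R else (k%:R ^+ 2)%R else k%:R.
transitivity (\int[P]_w (\prod_p f p (point_count X (B p) w))%:E).
  apply: eq_integral => w _; congr EFin.
  rewrite -(pair_bigA _ (fun i b => f (i, b) (point_count X (B (i, b)) w))) /=.
  apply: eq_bigr => i _; rewrite big_bool /f /B /=; case: eqP => [<-|_].
    by rewrite mul1r expr2.
  by rewrite mulrC.
rewrite integral_prod_point_count.
- rewrite -(pair_bigA _ (fun i b => \int[P]_w (f (i, b) (point_count X (B (i, b)) w))%:E)) /=.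
  rewrite -prodEFin; apply: eq_bigr => i _; rewrite big_bool /f /B /poisson_weight /=.
  case: eqP => [_|_].
    by rewrite integral_cst//= probability_setT !mul1e mul1r integral_cell_count_sqr.
  by rewrite !integral_cell_count// mul0r addr0 expr2.
- by move=> [i []]; rewrite /B /=; [case: ifP => // _|]; exact: mA.
- by move=> [i []]; rewrite /B /=; [case: ifP => _; first exact: sub0set|]; exact: AE.
- move=> [i b] [j b'] _ _ [x []]; rewrite /B /=.
  case: b b' => -[].
  + case: ifP => //_; case: ifP => // _ /disjA h /h.
    by move=> /(_ (ltn_ord i) (ltn_ord j) (c'n i) (c'n j))[/val_inj ->].
  + case: ifP => // cc' /disjA h /h.
    move=> /(_ (ltn_ord i) (ltn_ord j) (c'n i) (cn j))[/val_inj ij].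
    by rewrite -ij => /esym/eqP; rewrite cc'.
  + case: ifP => // cc' h1 h2.
    have [/val_inj ij] := disjA (ltn_ord i) (ltn_ord j) (cn i) (c'n j) h1 h2.
    by rewrite ij => /eqP; rewrite cc'.
  + move=> /disjA h /h.
    by move=> /(_ (ltn_ord i) (ltn_ord j) (cn i) (cn j))[/val_inj ->].
- by move=> [i b] k; rewrite /f /=; case: ifP => _ //; case: b.
Qed.

End poisson_array.

(** * Hops as chains of levels *)

Section hop_count.
Variables (R : realType) (r : R).
Implicit Types (Y : {fset R}) (t : R).

(** Recursion on the last intermediate node; [j] is the number of intermediate nodes, hence [j.+1]
    hops. *)
Fixpoint hop_count Y (j : nat) t : nat :=
  if j is j'.+1 then \sum_(x <- Y | (x < t) && (t - x <= r)) hop_count Y j' x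
  else (0 < t) && (t <= r).

Lemma sigma_hop_count Y j t : sigma r j.+1 Y t = hop_count Y j t.
Proof.
rewrite /sigma /=; elim: j t => [|j IHj] t /=.
  rewrite -sum1_card big_mkcond (bigD1 [tuple])//= big1 => [|s /negP]; last first.
    by case; rewrite [s]tuple0.
  by rewrite unfold_in /= /hop_path /= subr0 andbT addn0; case: ifP.
rewrite big_mkcond big_seq_fsetE /= -sum1_card big_mkcond /=.
rewrite (reindex (fun p : Y * j.-tuple Y => rcons_tuple p.2 p.1)) /=; last first.
  apply/onW_bij/inj_card_bij => [[x s] [y s'] /(congr1 val) /= /rcons_inj[/val_inj -> ->]//|].
  by rewrite card_prod !card_tuple expnS.
rewrite -(pair_bigA _ (fun (x : Y) (s : j.-tuple Y) =>
   if rcons_tuple s x \in [pred s : (j.+1).-tuple Y | hop_path r t [seq val x | x <- s]]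
   then 1 else 0)%N) /=.
apply: eq_bigr => x _; rewrite -IHj -sum1_card -big_mkcond /=.
have inE' (s : j.-tuple Y) : (rcons_tuple s x \in
    [pred s : (j.+1).-tuple Y | hop_path r t [seq val x | x <- s]]) =
    (val x < t) && (t - val x <= r) && (hop_path r (val x) [seq val x | x <- s]).
  by rewrite unfold_in /= /hop_path map_rcons rcons_path last_rcons andbC.
under eq_bigl do rewrite inE'.
by case: ifP => _; [apply: eq_bigl|rewrite big_pred0].
Qed.

Hypothesis r_gt0 : 0 < r.

Lemma hop_count_eq0 Y j t : j.+1%:R * r < t -> hop_count Y j t = 0%N.
Proof.
elim: j t => [|j IHj] t /=; first by rewrite mul1r ltNge andbC => /negPf ->.
move=> jt; rewrite big1// => x /andP[_ txr]; apply: IHj.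
by move: jt txr; rewrite -[j.+2%:R]natr1 mulrDl mul1r; lra.
Qed.

Variable tau : R.

(* The number of chains [0 <= u_1 <= ... <= u_j <= a], with [u_i < tau] and
   [u_i = i r - x] for some [x] in [Y]. *)
Fixpoint level_chains Y (j : nat) (a : R) : nat :=
  if j is j'.+1 then
    \sum_(x <- Y | (0 <= j'.+1%:R * r - x < tau) && (j'.+1%:R * r - x <= a))
      level_chains Y j' (j'.+1%:R * r - x)
  else 1.

(** With [x = (j+1) r - u], the hop from [x] to [(j+2) r - a] has length [r + u - a], at most [r]
    exactly when [u <= a]. Nodes with [u < 0] are out of reach of [j+1] hops. *)
Lemma hop_count_level_chains Y j (a : R) : tau <= r -> 0 <= a -> a < tau ->
  hop_count Y j (j.+1%:R * r - a) = level_chains Y j a.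
Proof.
move=> tau_le_r; elim: j a => [|j IHj] a a0 atau /=.
  by rewrite mul1r; have -> // : (0 < r - a) && (r - a <= r) by apply/andP; split; lra.
rewrite big_mkcond [RHS]big_mkcond; apply: eq_bigr => x _.
rewrite -[j.+2%:R]natr1 mulrDl mul1r.
set u := j.+1%:R * r - x; have xE : x = j.+1%:R * r - u by rewrite /u; ring.
have [u0|u0] := ltP u 0; last first.
  case: ifPn => /= [/andP[_ xa]|xa].
    have utau : u < tau by move: xa; rewrite xE; lra.
    have ua : u <= a by move: xa; rewrite xE; lra.
    by rewrite utau ua [in LHS]xE IHj.
  rewrite ifF//; apply/negbTE; apply: contra xa => /andP[_ ua].
  by rewrite xE; apply/andP; split; lra.
by case: ifP => // _; rewrite hop_count_eq0// xE; lra.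
Qed.

(** At [a = tau] two boundary cases must be excluded: [u = tau], a hop of length [r] that the levels
    omit, and [u = 0], a hop of length 0 if [tau = r]. *)
Lemma hop_count_level_chains_tau Y j : tau <= r ->
  j.+1%:R * r \notin Y -> j.+1%:R * r - tau \notin Y ->
  hop_count Y j.+1 (j.+2%:R * r - tau) = level_chains Y j.+1 tau.
Proof.
move=> tau_le_r jrY jrtY /=; rewrite big_seq_cond [RHS]big_seq_cond big_mkcond [RHS]big_mkcond.
apply: eq_bigr => x _; have [xY|//] := boolP (x \in Y).
have xr : x != j.+1%:R * r by apply: contraNN jrY => /eqP <-.
have xrt : x != j.+1%:R * r - tau by apply: contraNN jrtY => /eqP <-.
rewrite -[j.+2%:R]natr1 mulrDl mul1r /=.
set u := j.+1%:R * r - x; have xE : x = j.+1%:R * r - u by rewrite /u; ring.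
have u_neq0 : u != 0 by apply: contraNN xr => /eqP u0; rewrite xE u0 subr0.
have u_neqtau : u != tau by apply: contraNN xrt => /eqP u0; rewrite xE u0.
have [u0|u0] := ltP u 0.
  by case: ifP => // _; rewrite hop_count_eq0// xE; lra.
have {u0}u_neq0 : 0 < u by rewrite lt_neqAle eq_sym u_neq0.
case: ifPn => /= [/andP[_ xa]|xa].
  have utau : u < tau by rewrite lt_neqAle u_neqtau; move: xa; rewrite xE; lra.
  by rewrite utau (ltW utau) [in LHS]xE hop_count_level_chains// ltW.
rewrite ifF//; apply/negbTE; apply: contra xa => /andP[utau _].
by rewrite xE; apply/andP; split; lra.
Qed.

End hop_count.

(** * Discretisation of the levels *)

Section cells.
Variables (T : Type) (R : realType) (X : T -> {fset R}) (r tau : R).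
Hypothesis tau_ge0 : 0 <= tau.
Implicit Types (h : R) (w : T).

(* The points [x] whose level [i.+1 r - x] lies in [[c h, (c+1) h)]. *)
Definition cell h (i c : nat) : set R :=
  [set` `]i.+1%:R * r - c.+1%:R * h, i.+1%:R * r - c%:R * h]].

Lemma cellE h i c x :
  (x \in cell h i c) = (c%:R * h <= i.+1%:R * r - x < c.+1%:R * h).
Proof.
have -> : (x \in cell h i c) = (x \in `]i.+1%:R * r - c.+1%:R * h, i.+1%:R * r - c%:R * h]).
  by apply/idP/idP => [/set_mem//|?]; exact/mem_set.
by rewrite in_itv /= andbC lerBrDr -lerBrDl ltrBlDr -ltrBlDl.
Qed.

Lemma point_countE (A : set R) w :
  (point_count X A w)%:R = \sum_(x <- X w) (x \in A)%:R :> R.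
Proof.
rewrite /point_count card_fset_sum1 big_fset /= big_mkcond natr_sum.
by apply: eq_bigr => x _; case: ifP.
Qed.

Lemma sum_cell n i x b (G : nat -> R) : (b <= n.+1)%N ->
  let u := i.+1%:R * r - x in let c := Num.truncn (u / (tau / n.+1%:R)) in
  \sum_(c < b) (x \in cell (tau / n.+1%:R) i c)%:R * G c =
  if (0 <= u < tau) && (c < b)%N then G c else 0.
Proof.
move=> bn u c; under eq_bigr do rewrite cellE -/u.
have n0 : 0 < n.+1%:R :> R by rewrite ltr0n.
(* For [tau = 0] all cells are empty and both sides vanish. *)
move: tau_ge0; rewrite le_eqVlt => /predU1P[<-|tau0].
  have -> : (0 <= u < 0) = false by apply/negP => /andP[u0 /(le_lt_trans u0)]; rewrite ltxx.
  apply: big1 => d _; rewrite mul0r !mulr0.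
  have -> : (0 <= u < 0) = false by apply/negP => /andP[u0 /(le_lt_trans u0)]; rewrite ltxx.
  by rewrite mul0r.
have h0 : 0 < tau / n.+1%:R by rewrite divr_gt0.
have [u0|u0] := ltP u 0.
  by apply: big1 => d _; rewrite leNgt (lt_le_trans u0) ?mul0r// mulr_ge0// ltW.
have dE d : (d%:R * (tau / n.+1%:R) <= u < d.+1%:R * (tau / n.+1%:R)) = (c == d).
  by rewrite truncn_eq ?divr_ge0 ?(ltW h0)// ler_pdivlMr// ltr_pdivrMr.
under eq_bigr do rewrite dE.
case: ltnP => cb; last first.
  rewrite andbF; apply: big1 => d _; rewrite gtn_eqF ?mul0r//.
  exact: leq_trans (ltn_ord d) cb.
have utau : u < tau.
  have := leq_trans cb bn; rewrite truncn_lt_nat ?divr_ge0 ?(ltW h0)//.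
  by rewrite ltr_pdivrMr// mulrCA mulfV ?mulr1// gt_eqF.
rewrite utau /= (bigD1 (Ordinal cb))//= eqxx mul1r big1 ?addr0// => d.
by rewrite -val_eqE /= eq_sym => /negPf ->; rewrite mul0r.
Qed.

Lemma sum_cell_count n i b w (G : nat -> R) : (b <= n.+1)%N ->
  \sum_(c < b) cell_count X (cell (tau / n.+1%:R)) i c w * G c =
  \sum_(x <- X w | 0 <= i.+1%:R * r - x < tau)
    if (Num.truncn ((i.+1%:R * r - x) / (tau / n.+1%:R)) < b)%N
    then G (Num.truncn ((i.+1%:R * r - x) / (tau / n.+1%:R))) else 0.
Proof.
move=> bn; rewrite /cell_count; under eq_bigr do rewrite point_countE mulr_suml.
rewrite exchange_big [RHS]big_mkcond /=; apply: eq_bigr => x _.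
by rewrite sum_cell//; case: (0 <= _ < tau).
Qed.

Local Notation cell_chains n w := (chains (fun i c => cell_count X (cell (tau / n.+1%:R)) i c w)).

(** Dropping the order constraint leaves the product of the total counts of the levels, which is the
    sum for the single cell [[0, tau)]. It serves as dominating function. *)
Lemma cell_chains_le_total n j b w : (b <= n.+1)%N ->
  cell_chains n w j b <= cell_chains 0%N w j 1.
Proof.
elim: j b => [//|j IHj] b bn /=.
rewrite [leRHS]big_ord1 /=.
apply: (@le_trans _ _ (\sum_(c < b) cell_count X (cell (tau / n.+1%:R)) j c w *
    cell_chains 0%N w j 1)).
  apply: ler_sum => c _; rewrite ler_wpM2l ?cell_count_ge0// IHj//.
  exact: leq_trans (ltn_ord c) bn.
have C0 : 0 <= cell_chains 0%N w j 1.
  by rewrite chains_pair; apply: pair_chains_ge0 => *; exact: cell_count_ge0.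
rewrite -mulr_suml ler_wpM2r//.
have := @sum_cell_count n j b w (fun=> 1) bn.
under eq_bigr do rewrite mulr1; move=> ->.
have := @sum_cell_count 0 j 1 w (fun=> 1) (leqnn 1).
rewrite big_ord1 mulr1 /= => ->.
apply: ler_sum => x /andP[x0 xtau]; rewrite divr1.
rewrite [X in _ <= X]ifT; last first.
  by rewrite truncn_lt_nat ?divr_ge0// ltr_pdivrMr ?mul1r// (le_lt_trans x0).
by case: ifP.
Qed.

(** The bound [b n] is general so that the induction can continue from a point of level [u], with
    its cell index plus one as bound and [u] as [a]. *)
Lemma cvg_cell_chains w j a (b : nat -> nat) :
  (forall n, (b n <= n.+1)%N) ->
  (forall u, 0 <= u -> u < tau ->
    \forall n \near \oo, (Num.truncn (u / (tau / n.+1%:R)) < b n)%N = (u <= a)) ->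
  cell_chains n w j (b n) @[n --> \oo] --> ((level_chains r tau (X w) j a)%:R : R).
Proof.
elim: j a b => [|j IHj] a b bn bu /=; first exact: cvg_cst.
under eq_fun => n do rewrite (sum_cell_count j w (fun c => cell_chains n w j c.+1) (bn n)).
rewrite natr_sum big_mkcondr /=; apply: cvg_sumr => x /andP[]; set u := _ - x.
move=> u0 utau.
have tau0 : 0 < tau by exact: le_lt_trans utau.
pose v n := Num.truncn (u / (tau / n.+1%:R)).
have vn n : (v n < n.+1)%N.
  rewrite truncn_lt_nat ?divr_ge0// ltr_pdivrMr ?divr_gt0//.
  by rewrite mulrCA mulfV ?mulr1// pnatr_eq0.
have cvgv : cell_chains n w j (v n).+1 @[n --> \oo] -->
    ((level_chains r tau (X w) j u)%:R : R).
  apply: IHj => // u' u'0 u'tau.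
  have [u'u|uu'] := leP u' u.
    by near=> n; rewrite ltnS; apply: le_truncn; rewrite ler_pM2r// invr_gt0 divr_gt0.
  (* Levels [u < u'] fall into distinct cells as soon as [n >= tau / (u' - u)]. *)
  near=> n; apply/negbTE; rewrite -leqNgt truncn_ge_nat ?divr_ge0//.
  have h0 : 0 < tau / n.+1%:R by rewrite divr_gt0.
  rewrite -natr1 (@le_trans _ _ (u / (tau / n.+1%:R) + 1))//.
    by rewrite lerD2r truncn_le divr_ge0// ltW.
  rewrite -lerBrDl -mulrBl ler_pdivlMr// mul1r.
  rewrite ler_pdivrMr ?ltr0n// -ler_pdivrMl ?subr_gt0//.
  apply: (@le_trans _ _ n%:R); last by rewrite ler_nat.
  by near: n; exact: nbhs_infty_ger.
case: (leP u a) => ua.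
  apply: cvg_trans cvgv; apply: near_eq_cvg.
  by near=> n; rewrite (near (bu u u0 utau) n) ?ua.
apply: cvg_near_cst; near=> n.
by rewrite (near (bu u u0 utau) n) ?leNgt ?ua.
Unshelve. all: by end_near. Qed.

End cells.

(** * The variance *)

Section limits.
Local Open Scope ereal_scope.
Context d (T : measurableType d) (R : realType) (P : probability T R).

Lemma ge0_integrable_fin (f : T -> R) (L : R) : measurable_fun [set: T] f ->
  (forall x, (0 <= f x)%R) -> \int[P]_x (f x)%:E = L%:E ->
  P.-integrable [set: T] (EFin \o f).
Proof.
move=> mf f0 fL; apply/integrableP; split; first exact/measurable_EFinP.
rewrite (eq_integral (EFin \o f)); first by rewrite fL ltry.
by move=> x _; rewrite /= ger0_norm.
Qed.

Lemma dominated_integral_eq (f_ : nat -> T -> R) (f g : T -> R) (l : nat -> R) (L : R) :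
  (forall n, measurable_fun [set: T] (f_ n)) ->
  (forall x, f_ n x @[n --> \oo] --> f x) ->
  P.-integrable [set: T] (EFin \o g) ->
  (forall n x, `|f_ n x| <= g x)%R ->
  (forall n, \int[P]_x (f_ n x)%:E = (l n)%:E) ->
  l n @[n --> \oo] --> L ->
  P.-integrable [set: T] (EFin \o f) /\ \int[P]_x (f x)%:E = L%:E.
Proof.
move=> mf_ f_f ig f_g fl lL.
have mf : measurable_fun [set: T] f by apply: (measurable_fun_cvg mf_) => x _; exact: f_f.
have := @dominated_convergence _ _ _ P _ measurableT (fun n => EFin \o f_ n)
  (EFin \o f) (EFin \o g).
case=> //.
- by move=> n; exact/measurable_EFinP.
- exact/measurable_EFinP.
- apply: aeW => x _; apply: cvg_EFin; first exact: nearW.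
  exact: f_f.
- by apply: aeW => x n _; rewrite lee_fin.
move=> intf _ cvgf; split=> //.
have lL' : (l n)%:E @[n --> \oo] --> L%:E by apply: cvg_EFin => //; exact: nearW.
apply: (cvg_unique _ cvgf) => //.
by rewrite (_ : [sequence _]_n = (fun n => (l n)%:E))//; apply/funext => n; rewrite -fl.
Qed.

Lemma variance_off_null (N : set T) (f g : T -> R) :
  measurable N -> P N = 0 -> (forall x, (0 <= f x)%R) -> (forall x, (0 <= g x)%R) ->
  (forall x, ~ N x -> f x = g x) -> 'V_P[f] = 'V_P[g].
Proof.
move=> mN N0 f0 g0 fg; rewrite /variance unlock /=.
have -> : 'E_P[f] = 'E_P[g].
  rewrite unlock; apply: (ge0_eq_integral_off_null mN N0) => [x|x|x /fg ->//];
  by rewrite lee_fin.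
rewrite unlock; apply: (ge0_eq_integral_off_null mN N0) => [x|x|x /fg fx].
- by rewrite lee_fin -expr2 sqr_ge0.
- by rewrite lee_fin -expr2 sqr_ge0.
by rewrite !fctE /= fx.
Qed.

Lemma varianceEintegral (f : T -> R) (a b : R) :
  P.-integrable [set: T] (EFin \o f) ->
  P.-integrable [set: T] (EFin \o (fun x => f x ^+ 2)%R) ->
  \int[P]_x (f x)%:E = a%:E -> \int[P]_x (f x ^+ 2)%:E = b%:E ->
  'V_P[f] = (b - a ^+ 2)%:E.
Proof.
move=> f1 f2 fa fb; have f1' : f \in Lfun P 1 by apply/Lfun1_integrable.
rewrite /variance covarianceE//; last first.
  by apply/Lfun1_integrable; apply: eq_integrable f2 => // x _; rewrite /= expr2.
rewrite unlock fa; under eq_integral do rewrite fctE -expr2.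
by rewrite fb.
Qed.

End limits.

Section variance_sigma.
Context (d : measure_display) (T : measurableType d)
    (R : realType) (P : probability T R)
    (r tau : R) (m : nat) (lambda : nat -> R) (rho : R -> R)
    (X : T -> {fset R}).
Hypotheses (r_gt0 : 0 < r) (tau_ge0 : 0 <= tau) (tau_le_r : tau <= r)
    (lambda_gt0 : forall i : nat, (1 <= i < m.+2)%N -> 0 < lambda i)
    (rho_cell : forall i : nat, (1 <= i < m.+2)%N ->
      forall x : R, (i - 1)%N%:R * r < x <= i%:R * r -> rho x = lambda i)
    (X_poisson : poisson_process P [set` `[0, m.+2%:R * r]] rho X).

(** The count of a singleton is Poisson of rate 0. *)
Lemma null_node x : [set` `[0, m.+2%:R * r]] x ->
  measurable [set w | x \in X w] /\ P [set w | x \in X w] = 0.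
Proof.
move=> Ex; have xE : [set x] `<=` [set` `[0, m.+2%:R * r]] by move=> _ ->.
have -> : [set w | x \in X w] = [set w | [set k | k <> 0%N] (point_count X [set x] w)].
  apply/seteqP; split => w /=; rewrite /point_count.
    move=> xw /eqP; rewrite cardfs_eq0 => /eqP/fsetP/(_ x).
    by rewrite !inE /= xw mem_set.
  move/eqP; rewrite cardfs_eq0 => /fset0Pn[y]; rewrite !inE /= => /andP[yw].
  by move=> /set_mem <-.
have mx : measurable [set x] by exact: measurable_set1.
split.
  apply: measurable_nat_preimage; exact: (measurable_point_count X_poisson).
rewrite (poisson_point_count X_poisson)// Rintegral_set1 /poisson_prob ltxx.
by rewrite diracE memNset.
Qed.

Let h n : R := tau / n.+1%:R.

Let h_ge0 n : 0 <= h n.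
Proof. by rewrite /h divr_ge0. Qed.

Lemma cell_bounds n i c x : (c <= n)%N -> cell r (h n) i c x ->
  [/\ 0 <= i.+1%:R * r - x, i.+1%:R * r - x < tau,
      c%:R * h n <= i.+1%:R * r - x & i.+1%:R * r - x < c.+1%:R * h n].
Proof.
move=> cn /mem_set; rewrite cellE => /andP[l u]; split=> //.
  by rewrite (le_trans _ l)// mulr_ge0.
rewrite (lt_le_trans u)// /h mulrA ler_pdivrMr// mulrC ler_wpM2l//.
by rewrite ler_nat.
Qed.

Lemma cell_sub n i c : (i < m.+1)%N -> (c <= n)%N ->
  cell r (h n) i c `<=` [set` `[0, m.+2%:R * r]].
Proof.
move=> im cn x /(cell_bounds cn)[x0 xtau _ _]; rewrite /= in_itv /=.
have ir : (i.+1%:R * r <= m.+2%:R * r :> R).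
  by rewrite ler_wpM2r ?(ltW r_gt0)// ler_nat ltnW.
have i1 : r <= i.+1%:R * r by rewrite ler_peMl ?(ltW r_gt0)// ler1n.
by have tr := tau_le_r; apply/andP; split; lra.
Qed.

Lemma cell_disjoint n i c i' c' x : (c <= n)%N -> (c' <= n)%N ->
  cell r (h n) i c x -> cell r (h n) i' c' x -> i = i' /\ c = c'.
Proof.
move=> cn c'n /(cell_bounds cn)[x0 xtau l u] /(cell_bounds c'n)[x0' xtau' l' u'].
have lt_level (a b : nat) : 0 <= a.+1%:R * r - x -> b.+1%:R * r - x < tau -> (b <= a)%N.
  move=> a0 btau; rewrite leqNgt; apply/negP => ab.
  have : (a.+2%:R * r <= b.+1%:R * r :> R) by rewrite ler_wpM2r ?(ltW r_gt0)// ler_nat.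
  by rewrite -[a.+2%:R]natr1 mulrDl mul1r; have := tau_le_r; lra.
have ii' : i = i' by apply/eqP; rewrite eqn_leq !lt_level.
split=> //; rewrite -ii' in l' u'.
have lt_c (a b : nat) : a%:R * h n <= i.+1%:R * r - x ->
    i.+1%:R * r - x < b.+1%:R * h n -> (a <= b)%N.
  move=> la ub; rewrite -ltnS ltnNge; apply/negP => ba.
  have : b.+1%:R * h n <= a%:R * h n by rewrite ler_wpM2r// ler_nat.
  lra.
by apply/eqP; rewrite eqn_leq !lt_c.
Qed.

Lemma Rintegral_cell n i c : (i < m.+1)%N -> (c <= n)%N ->
  Rintegral (@lebesgue_measure R) (cell r (h n) i c) rho = lambda i.+1 * h n.
Proof.
move=> im cn; rewrite (@eq_Rintegral _ _ _ _ _ (fun=> lambda i.+1)); last first.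
  move=> x /set_mem /(cell_bounds cn)[x0 xtau _ _].
  apply: rho_cell; first by rewrite ltnS.
  rewrite subn1 /=; move: x0 xtau; rewrite -[i.+1%:R]natr1 mulrDl mul1r.
  by move=> ? ?; have tr := tau_le_r; apply/andP; split; lra.
have mc : measurable (cell r (h n) i c) by exact: measurable_itv.
transitivity (lambda i.+1 * fine (lebesgue_measure (cell r (h n) i c))); first exact: Rintegral_cst.
congr (_ * _).
rewrite /cell lebesgue_measure_itv /= lte_fin.
have -> : c.+1%:R * h n = c%:R * h n + h n by rewrite -natr1 mulrDl mul1r.
have := h_ge0 n; rewrite le_eqVlt => /predU1P[<-|h0].
  by rewrite addr0 ltxx.
have -> /= : i.+1%:R * r - (c%:R * h n + h n) < i.+1%:R * r - c%:R * h n by lra.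
by ring.
Qed.

(** [Z n] is the discretised path count, and [S] its pointwise limit, almost surely equal to
    [sigma]. *)
Let Z n w := chains (fun i c => cell_count X (cell r (h n)) i c w) m.+1 n.+1.
Let S w : R := (level_chains r tau (X w) m.+1 tau)%:R.

Let lambda_h_ge0 n i : (i < m.+1)%N -> 0 <= lambda i.+1 * h n.
Proof. by move=> im; rewrite mulr_ge0// ltW// lambda_gt0// ltnS. Qed.

Let mZ n : measurable_fun [set: T] (Z n).
Proof.
apply: (measurable_chains X_poisson (n := n)) => //.
- by move=> i c _ _; exact: measurable_itv.
- by move=> i c; exact: cell_sub.
Qed.

Let Z_ge0 n w : 0 <= Z n w.
Proof. by rewrite /Z chains_pair; apply: pair_chains_ge0 => *; exact: cell_count_ge0. Qed.

Let int_Z n : (\int[P]_w (Z n w)%:E = (chains (fun i _ => lambda i.+1 * h n) m.+1 n.+1)%:E)%E.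
Proof.
apply: (integral_chains X_poisson (n := n)) => //.
- by move=> i c _ _; exact: measurable_itv.
- by move=> i c; exact: cell_sub.
- by move=> i c i' c' x _ _; exact: cell_disjoint.
- by move=> i c; exact: Rintegral_cell.
- by move=> i; exact: lambda_h_ge0.
Qed.

Let int_Z2 n : (\int[P]_w (Z n w ^+ 2)%:E =
  (pair_chains (poisson_weight (fun i => lambda i.+1 * h n)) m.+1 n.+1 n.+1)%:E)%E.
Proof.
apply: (integral_chains_sqr X_poisson (n := n)) => //.
- by move=> i c _ _; exact: measurable_itv.
- by move=> i c; exact: cell_sub.
- by move=> i c i' c' x _ _; exact: cell_disjoint.
- by move=> i c; exact: Rintegral_cell.
- by move=> i; exact: lambda_h_ge0.
Qed.

Let cvg_Z w : Z n w @[n --> \oo] --> S w.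
Proof.
apply: cvg_cell_chains => // u u0 utau; have tau0 := le_lt_trans u0 utau.
apply: nearW => n; rewrite (ltW utau) truncn_lt_nat ?divr_ge0//.
by rewrite ltr_pdivrMr ?divr_gt0// mulrCA mulfV ?mulr1// pnatr_eq0.
Qed.

Let Z_le n w : Z n w <= Z 0%N w.
Proof. exact: cell_chains_le_total. Qed.

Lemma variance_sigma :
  'V_P[fun w => (sigma r m.+2 (X w) (m.+2%:R * r - tau))%:R] =
  (\sum_(l < m.+1) tau ^+ (2 * m.+1 - l.+1) *
    (top_coef (fun i => lambda i.+1) l.+1 m.+1 / (2 * m.+1 - l.+1)`!%:R))%:E.
Proof.
have mr_E : [set` `[0, m.+2%:R * r]] (m.+1%:R * r).
  by rewrite /= in_itv /= mulr_ge0 ?ler_wpM2r ?ler_nat ?(ltW r_gt0).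
have mrt_E : [set` `[0, m.+2%:R * r]] (m.+1%:R * r - tau).
  rewrite /= in_itv /= subr_ge0 (le_trans tau_le_r) ?ler_peMl ?ler1n ?(ltW r_gt0)//=.
  rewrite (@le_trans _ _ (m.+1%:R * r)) ?gerBl//.
  by rewrite ler_wpM2r ?ler_nat ?(ltW r_gt0).
have [mN1 N10] := null_node mr_E; have [mN2 N20] := null_node mrt_E.
(* The excluded null event is a node at an end of the last level interval, [u = 0] or [u = tau]. *)
rewrite (@variance_off_null _ _ _ _
    ([set w | m.+1%:R * r \in X w] `|` [set w | m.+1%:R * r - tau \in X w]) _ S).
- have [iS ES] : P.-integrable [set: T] (EFin \o S) /\ (\int[P]_x (S x)%:E =
    ((\prod_(i < m.+1) lambda i.+1) * (tau ^+ m.+1 / m.+1`!%:R))%:E)%E.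
    apply: (@dominated_integral_eq _ _ _ _ Z _ (Z 0%N)) => //.
    + exact: ge0_integrable_fin.
    + by move=> n x; rewrite ger0_norm.
    + exact: int_Z.
    + exact: cvg_chains.
  have [iS2 ES2] : P.-integrable [set: T] (EFin \o (fun w => S w ^+ 2)) /\
    (\int[P]_x (S x ^+ 2)%:E = (\sum_(l < m.+2) tau ^+ (2 * m.+1 - l) *
    (top_coef (fun i => lambda i.+1) l m.+1 / (2 * m.+1 - l)`!%:R))%:E)%E.
    apply: (@dominated_integral_eq _ _ _ _ (fun n w => Z n w ^+ 2) _ (fun w => Z 0%N w ^+ 2)).
    + by move=> n; exact: measurable_funX.
    + by move=> w; under eq_fun do rewrite expr2; rewrite expr2; exact: cvgM.
    + apply: ge0_integrable_fin (int_Z2 0%N); first exact: measurable_funX.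
      by move=> x; rewrite sqr_ge0.
    + by move=> n x; rewrite ger0_norm ?sqr_ge0// lerXn2r ?nnegrE.
    + exact: int_Z2.
    + exact: cvg_pair_chains.
  rewrite (varianceEintegral iS iS2 ES ES2); congr EFin.
  (* The term [l = 0] of the second moment cancels the squared mean. *)
  rewrite [X in X - _]big_ord_recl (top_coef0E (fun i => lambda i.+1)).
  by rewrite addrAC subrr add0r.
- exact: measurableU.
- exact: null_set_setU.
- by move=> w; exact: ler0n.
- by move=> w; exact: ler0n.
move=> w /not_orP[/negP n1 /negP n2].
by rewrite sigma_hop_count hop_count_level_chains_tau.
Qed.

End variance_sigma.

Theorem proposition4p2 (d : measure_display) (T : measurableType d)
    (R : realType) (P : probability T R)
    (r tau : R) (k : nat) (lambda : nat -> R) (rho : R -> R)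
    (X : T -> {fset R})
    (r_gt0 : 0 < r) (k_ge2 : (2 <= k)%N)
    (tau_ge0 : 0 <= tau) (tau_le_r : tau <= r)
    (lambda_gt0 : forall i : nat, (1 <= i < k)%N -> 0 < lambda i)
    (rho_cell : forall i : nat, (1 <= i < k)%N ->
      forall x : R, (i - 1)%N%:R * r < x <= i%:R * r -> rho x = lambda i)
    (X_poisson : poisson_process P [set` `[0, k%:R * r]] rho X) :
  'V_P[fun w => (sigma r k (X w) (k%:R * r - tau))%:R] =
  (\sum_(1 <= l < k)
     tau ^+ (2 * k - 2 - l) *
     ((\prod_(1 <= i < k) lambda i ^+ 2) / (2 * k - 2 - l)`!%:R) *
     \sum_(j : {ffun 'I_l.+1 -> 'I_k} | (\sum_(p < l.+1) j p == k - 1 - l)%N)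
       (\prod_(1 <= q < l.+1)
          (lambda (\sum_(p < l.+1 | (p < q)%N) j p + q)%N)^-1) *
       (\prod_(p < l.+1) 'C(2 * j p, j p)%:R))%:E.
Proof.
(* With [k = m.+2] there are [m.+1] intermediate nodes, one per level. *)
case: k k_ge2 lambda_gt0 rho_cell X_poisson => [//|[//|m]] _ lambda_gt0 rho_cell X_poisson.
rewrite (variance_sigma r_gt0 tau_ge0 tau_le_r lambda_gt0 rho_cell X_poisson).
congr EFin; rewrite [RHS]big_add1 [RHS]big_mkord; apply: eq_bigr => l _.
have -> : (2 * m.+2 - 2 - l.+1 = 2 * m.+1 - l.+1)%N by lia.
rewrite (@top_coefE _ _ m.+2)//; last first.
  by move=> i im; rewrite gt_eqF// lambda_gt0// ltnS.
rewrite -[RHS]mulrA; congr (_ * _); rewrite mulrAC; congr (_ / _ * _).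
  by rewrite big_add1 /= big_mkord.
apply: eq_bigl => j; move: (\sum_(p < l.+2) j p)%N (ltn_ord l) => s lm.
by apply/eqP/eqP; move: lm; move: (nat_of_ord l) => l1; lia.
Qed.
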